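(* Consider hidden Markov models with nearly-deterministic transition matrices $T=D+\varepsilon Q$, with drift parameter $\varepsilon$. Let the states be labelled so that $$D=\begin{bmatrix}P&D_{12}\\0&D_{22}\end{bmatrix}$$ with $P\in\mathbb R^{(N-r)\times(N-r)}$ the permutation matrix of the recurrent states $\widetilde{\mathcal X}=\{x_1,\dots,x_{N-r}\}$ of $D$, and $D_{22}\in\mathbb R^{r\times r}$ nilpotent. Let $M$ be the order of $P$ and let $\widetilde E$ be the submatrix of the emission matrix $E$ formed by its first $N-r$ columns. Assume: (i) $w_0=\begin{bmatrix}\widetilde w_0\\-\infty\mathbb 1_r\end{bmatrix}$ with $\|\widetilde w_0\|_\infty<\infty$; (ii) all entries of $\widetilde E$ are strictly positive, and no two columns of the stacked matrix $\widetilde E_s=\begin{bmatrix}\widetilde EP^0\\ \vdots\\ \widetilde EP^{M-1}\end{bmatrix}$ are identical. Let $\delta_\varepsilon$ be the adaptation parameter used for a given $\varepsilon$, let $\boldsymbol w_k$ be generated by the adaptive logit filter $$\boldsymbol w_k=\begin{bmatrix}P&0\\0&I_r\end{bmatrix}(1-\delta_\varepsilon)\boldsymbol w_{k-1}+\delta_\varepsilon\log(E^\top\boldsymbol y_k),\qquad k\ge1,$$ started at $w_0$, and let $p_k=\mathbb P\big[\arg\max_{x\in\mathcal X}\boldsymbol w_k(x)\ne\boldsymbol x_k^\star\big]$. (a) If $\lim_{\varepsilon\to0}\delta_\varepsilon=0$ and $\lim_{\varepsilon\to0}\varepsilon/\delta_\varepsilon=0$, then the filter consistently learns the true states as $\varepsilon\to0$: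 $$\lim_{\varepsilon\to0}\limsup_{k\to\infty}p_k=0.$$ (b) Moreover, if $\delta_\varepsilon=\lambda/\log(1/\varepsilon)$ with $\lambda\in(0,\xi)$, where the constant $\xi>0$, defined in the context, depends only on $P$ and the likelihood model $E$, then $$\limsup_{k\to\infty}p_k\le\kappa\,\varepsilon\log\frac1\varepsilon+o\Big(\varepsilon\log\frac1\varepsilon\Big),$$ with the constant $\kappa>0$ defined in the context. The resulting decay rate matches that of the Bayes-optimal decoder, in the sense that the long-term error of the latter is also dominated by an $\varepsilon\log(1/\varepsilon)$ term.
   Context: Hidden Markov model: state space $\mathcal X=\{x_1,\dots,x_N\}$, true state $\boldsymbol x_k^\star$ with $\boldsymbol x_0^\star\sim\pi_0$, column-stochastic $T=(t_{ij})$ with $t_{ij}=\mathbb P(\boldsymbol x^\star_{k+1}=x_i\mid\boldsymbol x^\star_k=x_j)$; observations $\boldsymbol y_k\in\mathcal Y=\{u_1,\dots,u_S\}$ (canonical basis vectors of $\mathbb R^S$), $k\ge1$, emission matrix $E\in\mathbb R^{S\times N}$ with $e_{ij}=\mathbb P(\boldsymbol y_k=u_i\mid\boldsymbol x_k^\star=x_j)$; write $\mathbb P(y\mid x)$ for these likelihoods. Nearly-deterministic matrix: $T=D+\varepsilon Q$ with small $0<\varepsilon<1$, where every column of $D$ is a canonical basis vector, and, $n_j$ denoting the row index of the unique $1$ in column $j$ of $D$, $q_{ij}\ge0$ for $i\ne n_j$ and $q_{n_jj}=-\sum_{i\ne n_j}q_{ij}$. Any such $D$ has, after relabelling of states, the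 stated block form, the last $r$ states being the transient states of $D$ (states that, once exited, cannot be reentered under $D$). Bayes-optimal decoder: the maximum a posteriori rule based on the exact belief vector $\mathbb P(\boldsymbol x_k^\star=\cdot\mid\boldsymbol y_{1:k})$, which achieves the minimum state-decoding error; the statement about its long-term error is attributed to Khasminskii and Zeitouni (Asymptotic filtering for finite state Markov chains, 1996). The order $M$ of $P$ is the smallest positive integer with $P^M=I$. $\sigma:\widetilde{\mathcal X}\to\widetilde{\mathcal X}$ is the permutation with $Pu_x=u_{\sigma(x)}$, where $u_{x_i}=u_i$. Conventions: $\log$ is entrywise, $\log0=-\infty$, $-\infty\cdot0=0$; $\boldsymbol w_k(x_i)$ is the $i$-th entry of $\boldsymbol w_k$. Constants. For distinct $x',x\in\widetilde{\mathcal X}$ and $n\in\{0,\dots,M-1\}$ let $$\Lambda_n^{x'}(t;x)=\log\sum_{y\in\mathcal Y}\mathbb P(y\mid\sigma^{-n}(x'))\left(\frac{\mathbb P(y\mid\sigma^{-n}(x'))}{\mathbb P(y\mid\sigma^{-n}(x))}\right)^t,\quad t\in\mathbb R,$$ $$d_n^{x'}(x)=\sum_{y\in\mathcal Y}\mathbb P(y\mid\sigma^{-n}(x'))\log\frac{\mathbb P(y\mid\sigma^{-n}(x'))}{\mathbb P(y\mid\sigma^{-n}(x))},$$ $$\Gamma^{x'}(x)=\{n\in\{0,\dots,M-1\}:\ \mathbb P(\cdot\mid\sigma^{-n}(x))\ne\mathbb P(\cdot\mid\sigma^{-n}(x'))\}.$$ Then $$\xi=\min_{x'\in\widetilde{\mathcal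 X}}\ \min_{x\in\widetilde{\mathcal X}\setminus\{x'\}}\ -\frac1M\sum_{n\in\Gamma^{x'}(x)}\int_0^{-1/M}\frac{\Lambda_n^{x'}(\tau;x)}{\tau}\,d\tau.$$ Let $W=\max\{\|\widetilde w_0\|_\infty,\max_{y\in\mathcal Y}\|\log(\widetilde E^\top y)\|_\infty\}$ and $q_{\min}=\min_jq_{n_jj}$. Then $$\kappa=\frac{-q_{\min}\,\alpha}{\lambda},$$ where $\alpha>0$ is a constant large enough that, for all distinct $x',x\in\widetilde{\mathcal X}$, $$\sum_{n\in\Gamma^{x'}(x)}\int_0^{-1/M}\frac{\Lambda_n^{x'}(\tau;x)}{\tau}d\tau+\lambda M+e^{-\alpha}\Big(\frac1M\sum_{n\in\Gamma^{x'}(x)}d_n^{x'}(x)+2W\Big)<0$$ (such $\alpha$ exists since $\lambda<\xi$). *)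

(* Defs.v *)
From HB Require Import structures.
From mathcomp Require Import all_boot all_order all_algebra all_fingroup.
From mathcomp Require Import all_classical all_reals all_analysis.

Set Implicit Arguments.
Unset Strict Implicit.
Unset Printing Implicit Defensive.

Import Order.TTheory GRing.Theory Num.Theory.
Import numFieldNormedType.Exports.

Local Open Scope classical_set_scope.
Local Open Scope ring_scope.

Section Matrices.
Context {R : realType}.

Definition basis_vec {n : nat} (i : 'I_n) : 'cV[R]_n := delta_mx i 0.

Definition column_stochastic {m n : nat} (A : 'M[R]_(m, n)) : Prop :=
  (forall i j, 0 <= A i j) /\ (forall j, \sum_i A i j = 1).

Definition nilpotent_mx {n : nat} (A : 'M[R]_n) : Prop :=
  exists k : nat, A ^+ k = 0.

Definition is_mx_order {n : nat} (P : 'M[R]_n) (M : nat) : Prop :=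
  [/\ (0 < M)%N, P ^+ M = 1%:M &
      forall k : nat, (0 < k)%N -> P ^+ k = 1%:M -> (M <= k)%N].

Definition drift_generator {n : nat} (nu : 'I_n -> 'I_n) (Q : 'M[R]_n) : Prop :=
  (forall i j, i != nu j -> 0 <= Q i j) /\
  (forall j, Q (nu j) j = - \sum_(i | i != nu j) Q i j).

End Matrices.

(* The set of all maximisers; it is a singleton iff there is no tie. *)
Definition argmax {d : Order.disp_t} {T : porderType d} {n : nat}
    (w : 'cV[T]_n) : {set 'I_n} :=
  [set x : 'I_n | [forall x' : 'I_n, (w x' 0 <= w x 0)%O]]%SET.

(* Observations are recorded by their index: [obs k w = i] stands for
   y_k = u_i = [basis_vec i].  Only the values [obs k] with k >= 1 are used. *)
Record hmm_process (R : realType) (N S : nat) := HMMProcess {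
  hmm_display : measure_display ;
  hmm_space : measurableType hmm_display ;
  hmm_prob : probability hmm_space R ;
  state : nat -> hmm_space -> 'I_N ;
  obs : nat -> hmm_space -> 'I_S
}.

Section HMM.
Context {R : realType} {N S : nat}.
Implicit Type H : hmm_process R N S.

(* The last clause is the Markov property together with the conditional
   independence of the observations given the states, written as the joint law
   of (x_0, ..., x_k, y_1, ..., y_k). *)
Definition is_hmm H (pi0 : 'cV[R]_N) (T : 'M[R]_N) (E : 'M[R]_(S, N)) : Prop :=
  [/\ column_stochastic pi0, column_stochastic T, column_stochastic E,
      (forall k i, measurable (state (h := H) k @^-1` [set i])) /\
      (forall k i, measurable (obs (h := H) k @^-1` [set i])) &
      forall (k : nat) (x : nat -> 'I_N) (y : nat -> 'I_S),
        hmm_prob H [set w | (forall j, (j <= k)%N -> state j w = x j) /\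
                            (forall j, (1 <= j <= k)%N -> obs j w = y j)] =
        (pi0 (x 0%N) 0 *
         \prod_(j < k) (T (x j.+1) (x j) * E (y j.+1) (x j.+1)))%:E].

(* The error event "argmax <> true state" occurs as soon as the true state is
   not the unique maximiser, so its probability bounds the error probability of
   every tie-breaking rule. *)
Definition decoding_error H (w : nat -> hmm_space H -> 'cV[\bar R]_N)
    (k : nat) : \bar R :=
  hmm_prob H [set o | argmax (w k o) != [set state k o]%SET].

Definition same_obs H (k : nat) (o : hmm_space H) : set (hmm_space H) :=
  [set o' | forall j, (1 <= j <= k)%N -> obs j o' = obs j o].

Definition belief H (k : nat) (o : hmm_space H) : 'cV[\bar R]_N :=
  \col_i (fine (hmm_prob H (state k @^-1` [set i] `&` same_obs k o)) /
          fine (hmm_prob H (same_obs k o)))%:E.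

(* Matrix-vector product with the convention 0 * -oo = 0 of [\bar R]. *)
Definition emulmx (A : 'M[R]_N) (v : 'cV[\bar R]_N) : 'cV[\bar R]_N :=
  \col_i (\sum_j (A i j)%:E * v j 0%R)%E.

(* [lne x%:E] is [-oo] for [x <= 0]. *)
Definition log_vec (v : 'cV[R]_N) : 'cV[\bar R]_N := map_mx (fun x => lne x%:E) v.

Fixpoint logit_filter (A : 'M[R]_N) (E : 'M[R]_(S, N)) (delta : R)
    (w0 : 'cV[\bar R]_N) (y : nat -> 'I_S) (k : nat) : 'cV[\bar R]_N :=
  if k is k'.+1 then
    let w := logit_filter A E delta w0 y k' in
    let l := log_vec (E^T *m basis_vec (y k)) in
    \col_i (emulmx A (\col_j ((1 - delta)%:E * w j 0%R)%E)%R i 0%R +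
            delta%:E * l i 0%R)%E
  else w0.

End HMM.

Section Constants.
Context {R : realType} {m S : nat}.
(* [Et] is the emission matrix restricted to the recurrent states, so that
   [Et y x] is P(y | x); [sigma] is the permutation of P and [M] its order. *)
Variables (Et : 'M[R]_(S, m)) (sigma : 'S_m) (M : nat).

Definition back (n : nat) (x : 'I_m) : 'I_m := (sigma ^- n)%g x.

Definition Lambda (x' : 'I_m) (n : nat) (t : R) (x : 'I_m) : R :=
  ln (\sum_(y < S) Et y (back n x') *
        (Et y (back n x') / Et y (back n x)) `^ t).

Definition dcoef (x' : 'I_m) (n : nat) (x : 'I_m) : R :=
  \sum_(y < S) Et y (back n x') * ln (Et y (back n x') / Et y (back n x)).

Definition GammaSet (x' x : 'I_m) : {set 'I_M} :=
  [set n : 'I_M | col (back n x) Et != col (back n x') Et]%SET.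

(* The integral from 0 to -1/M is minus the integral over [-1/M, 0]. *)
Definition Lambda_int (x' : 'I_m) (n : nat) (x : 'I_m) : R :=
  - \int[lebesgue_measure]_(t in `[- M%:R^-1, 0]) (Lambda x' n t x / t).

(* Equal to +oo when there is a single recurrent state (empty minimum). *)
Definition xi : \bar R :=
  \big[Order.min/+oo%E]_(x' < m) \big[Order.min/+oo%E]_(x < m | x != x')
    (- (M%:R^-1 * \sum_(n in GammaSet x' x) Lambda_int x' n x))%:E.

(* [`| _ |] is the sup norm on matrices. *)
Definition Wconst (wt0 : 'cV[R]_m) : R :=
  Num.max `|wt0|
    (\big[Num.max/0]_(y < S) `|map_mx (@ln R) (Et^T *m basis_vec y)|).

Definition alpha_admissible (wt0 : 'cV[R]_m) (lambda alpha : R) : Prop :=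
  0 < alpha /\
  forall x' x : 'I_m, x' != x ->
    \sum_(n in GammaSet x' x) Lambda_int x' n x + lambda * M%:R
    + expR (- alpha) *
      (M%:R^-1 * \sum_(n in GammaSet x' x) dcoef x' n x + 2 * Wconst wt0) < 0.

End Constants.

Section Kappa.
Context {R : realType} {N : nat}.

(* Under [drift_generator] all q_{n_j j} are nonpositive, so the default
   value 0 does not affect the minimum. *)
Definition q_min (nu : 'I_N -> 'I_N) (Q : 'M[R]_N) : R :=
  \big[Num.min/0]_(j < N) Q (nu j) j.

Definition kappa (nu : 'I_N -> 'I_N) (Q : 'M[R]_N) (alpha lambda : R) : R :=
  - q_min nu Q * alpha / lambda.

(* f(eps) <= c * eps log(1/eps) + o(eps log(1/eps)) as eps -> 0+ *)
Definition eps_log_bound (f : R -> \bar R) (c : R) : Prop :=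
  exists2 g : R -> R, g =o_ (0^'+) (fun eps : R => eps * ln (eps^-1)) &
    \forall eps \near 0^'+, (f eps <= (c * (eps * ln (eps^-1)) + g eps)%:E)%E.

End Kappa.

(* Main.v *)
(* Fix a window of K = M (I + 1) steps with I just above alpha / (M delta).
   Unless the chain deviates from D during the window or the few steps before it
   that empty the transient states, which has probability at most
   - eps q_min (K + const), the states of the window are determined by the
   current state x'.  The filter then prefers a wrong state x only if the sum of
   delta (1 - delta)^j times the log-likelihood ratios at lag j is at most
   2 W (1 - delta)^K.  Chernoff's bound with parameter 1 / (M delta) leaves the sum
   over j of Lambda_j (- (1 - delta)^j / M); grouped by residues mod M it is a
   Riemann sum of the monotone function Lambda_n (t) / t on a geometric grid, hence
   comparable with its integral, and admissibility of alpha turns the whole bound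
   into const * exp (- lambda / delta), uniformly in delta.  For
   delta = lambda / log (1 / eps) this is const * eps.  A posterior whose maximiser
   is wrong or tied has conditional error at most twice that of any other decoder,
   so the Bayes-optimal decoder inherits the bound of the filter. *)

Require Import Defs.
From HB Require Import structures.
From mathcomp Require Import all_boot all_order all_algebra all_fingroup.
From mathcomp Require Import all_classical all_reals all_analysis.
From mathcomp Require Import measurable_realfun.
From mathcomp Require Import ring lra zify.
Import Order.TTheory GRing.Theory Num.Theory.
Import numFieldNormedType.Exports.
Local Open Scope classical_set_scope.
Local Open Scope ring_scope.
Set Implicit Arguments.
Unset Strict Implicit.
Unset Printing Implicit Defensive.

(** * Probabilities of trajectories *)

Section RealProbability.
Context (R : realType) (d : measure_display) (T : measurableType d).
Variable P : probability T R.

Definition fine_pr (A : set T) : R := fine (P A).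
Local Notation pr := fine_pr.

Lemma prE A : measurable A -> P A = (pr A)%:E.
Proof. by move=> mA; rewrite /fine_pr fineK// fin_num_measure. Qed.

Lemma pr_ge0 A : 0 <= pr A.
Proof. exact/fine_ge0/measure_ge0. Qed.

Lemma pr_le A B : measurable A -> measurable B -> A `<=` B -> pr A <= pr B.
Proof.
by move=> mA mB AB; rewrite -lee_fin -!prE// le_measure ?inE.
Qed.

Lemma pr0 : pr set0 = 0.
Proof. by rewrite /fine_pr measure0. Qed.

Lemma prU_le A B : measurable A -> measurable B -> pr (A `|` B) <= pr A + pr B.
Proof.
move=> mA mB; rewrite -lee_fin EFinD -!prE//; last exact: measurableU.
exact: measureU2.
Qed.

Lemma pr_bigU_le (I : Type) (s : seq I) (B : I -> set T) :
  (forall i, measurable (B i)) ->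
  pr (\big[setU/set0]_(i <- s) B i) <= \sum_(i <- s) pr (B i).
Proof.
move=> mB; elim: s => [|i s IH]; first by rewrite !big_nil pr0.
rewrite !big_cons; apply: le_trans (prU_le _ _) _ => //.
  exact: bigsetU_measurable.
by rewrite lerD2l.
Qed.

Lemma pr_cover (F : finType) (B : F -> set T) A :
  measurable A -> (forall f, measurable (B f)) ->
  (forall t, A t -> exists f, B f t) -> pr A <= \sum_f pr (B f).
Proof.
move=> mA mB AB; apply: le_trans (pr_bigU_le _ mB).
apply: pr_le => //; first exact: bigsetU_measurable.
move=> t /AB[f Bt]; rewrite -bigcup_seq; exists f => //=.
by rewrite mem_index_enum.
Qed.

Lemma pr_partition (F : finType) (phi : T -> F) A : measurable A ->
  (forall f, measurable (phi @^-1` [set f])) ->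
  pr A = \sum_f pr (A `&` phi @^-1` [set f]).
Proof.
move=> mA mphi; have mAf f : measurable (A `&` phi @^-1` [set f]).
  exact: measurableI.
apply: EFin_inj; rewrite -prE// -sumEFin.
transitivity (P (\bigcup_(f in [set` index_enum F]) (A `&` phi @^-1` [set f]))).
  congr (P _); apply/seteqP; split=> t /=.
    by move=> At; exists (phi t) => //=; rewrite mem_index_enum.
  by case=> f _ [].
rewrite measure_fin_bigcup//; last first.
  by move=> f g _ _ [t [[_ /= <-] [_ /= <-]]].
rewrite -fsbig_seq ?index_enum_uniq//.
by apply: eq_bigr => f _; exact: prE.
Qed.

(** Such a set is a finite union of fibres of [phi]. With words of states and observations as [phi],
    this gives the measurability of every event met below. *)
Lemma finite_image_measurable (F : finType) (phi : T -> F) (A : set T) :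
  (forall f, measurable (phi @^-1` [set f])) ->
  (forall t t', phi t = phi t' -> A t -> A t') -> measurable A.
Proof.
move=> mphi detA.
have -> : A = \bigcup_(f in [set f | exists2 t, A t & phi t = f])
    (phi @^-1` [set f]).
  apply/seteqP; split=> t /=.
    by move=> At; exists (phi t) => //=; exists t.
  by case=> f [t' At' <-] /= e; apply: detA At'.
exact: fin_bigcup_measurable.
Qed.

End RealProbability.

(** * Path law of the hidden Markov chain and sums over trajectories *)

Section Paths.
Context {R : realType} {N S : nat}.
Variables (H : hmm_process R N S) (pi0 : 'cV[R]_N) (T : 'M[R]_N).
Variables (E : 'M[R]_(S, N)).
Hypothesis hH : is_hmm H pi0 T E.
Notation Omega := (hmm_space H).
Notation X := (@state R N S H).
Notation Y := (@obs R N S H).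
Notation pr := (fine_pr (hmm_prob H)).

Let pi0_ge0 x : 0 <= pi0 x 0. Proof. by case: hH => [[]]. Qed.
Let T_ge0 x' x : 0 <= T x' x. Proof. by case: hH => [_ []]. Qed.
Let E_ge0 y x : 0 <= E y x. Proof. by case: hH => [_ _ []]. Qed.

(** The index ranges are those of the joint law in [is_hmm]: states from time 0, observations from
    time 1. *)
Definition determined (k : nat) (A : set Omega) : Prop :=
  forall o o', (forall j, (j <= k)%N -> X j o = X j o') ->
    (forall j, (1 <= j <= k)%N -> Y j o = Y j o') -> A o -> A o'.

Definition obs_word (k : nat) (o : Omega) : {ffun 'I_k -> 'I_S} :=
  [ffun i : 'I_k => Y i.+1 o].

Definition state_word (k : nat) (o : Omega) : {ffun 'I_k.+1 -> 'I_N} :=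
  [ffun i : 'I_k.+1 => X i o].

Lemma obs_word_measurable k f : measurable (obs_word k @^-1` [set f]).
Proof.
have [_ _ _ [_ mY] _] := hH.
have -> : obs_word k @^-1` [set f] =
    \bigcap_(i in [set: 'I_k]) (Y i.+1 @^-1` [set f i]).
  apply/seteqP; split=> o /=.
    by move=> <- i _ /=; rewrite ffunE.
  by move=> h; apply/ffunP => i; rewrite ffunE; apply: h.
exact: fin_bigcap_measurable.
Qed.

Lemma state_word_measurable k f : measurable (state_word k @^-1` [set f]).
Proof.
have [_ _ _ [mX _] _] := hH.
have -> : state_word k @^-1` [set f] =
    \bigcap_(i in [set: 'I_k.+1]) (X i @^-1` [set f i]).
  apply/seteqP; split=> o /=.
    by move=> <- i _ /=; rewrite ffunE.
  by move=> h; apply/ffunP => i; rewrite ffunE; apply: h.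
exact: fin_bigcap_measurable.
Qed.

Lemma obs_word_eq k o o' : obs_word k o = obs_word k o' ->
  forall j, (1 <= j <= k)%N -> Y j o = Y j o'.
Proof.
move=> /ffunP e [//|j] /= jk.
by have := e (Ordinal jk); rewrite !ffunE.
Qed.

Lemma determined_measurable k A : determined k A -> measurable A.
Proof.
move=> detA.
apply: (@finite_image_measurable _ _ _
  (fun o => (state_word k o, obs_word k o))) => [[f g]|o o' [eX eY]].
  have -> : (fun o => (state_word k o, obs_word k o)) @^-1` [set (f, g)] =
      state_word k @^-1` [set f] `&` obs_word k @^-1` [set g].
    by apply/seteqP; split=> o /= [-> ->].
  apply: measurableI; [exact: state_word_measurable|exact: obs_word_measurable].
apply: detA; last exact: obs_word_eq.
move=> j jk; have jk' : (j < k.+1)%N by [].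
by move/ffunP/(_ (Ordinal jk')): eX; rewrite !ffunE.
Qed.

Definition cyl k (x : nat -> 'I_N) (y : nat -> 'I_S) : set Omega :=
  [set w | (forall j, (j <= k)%N -> X j w = x j) /\
           (forall j, (1 <= j <= k)%N -> Y j w = y j)].

Lemma cyl_determined k x y : determined k (cyl k x y).
Proof.
by move=> o o' eX eY [hx hy]; split=> j jk; rewrite -?eX -?eY ?hx ?hy.
Qed.

Definition upd (I : Type) (f : nat -> I) (n : nat) (v : I) : nat -> I :=
  fun j => if j == n then v else f j.

Lemma updE (I : Type) (f : nat -> I) n v j : (j < n)%N -> upd f n v j = f j.
Proof. by rewrite /upd => jn; rewrite ltn_eqF. Qed.

Lemma upd_id (I : Type) (f : nat -> I) n v : upd f n v n = v.
Proof. by rewrite /upd eqxx. Qed.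

(* In the trajectories that [F] is summed over, the coordinates after [k] and
   the observation at time 0 are junk. *)
Fixpoint pathsum (y0 : 'I_S) (k : nat)
    (F : (nat -> 'I_N) -> (nat -> 'I_S) -> R) : R :=
  if k is k'.+1 then
    pathsum y0 k'
      (fun x y => \sum_x' \sum_y' F (upd x k'.+1 x') (upd y k'.+1 y'))
  else \sum_x F (fun=> x) (fun=> y0).

Lemma pathsum_le y0 k F G : (forall x y, F x y <= G x y) ->
  pathsum y0 k F <= pathsum y0 k G.
Proof.
elim: k F G => [|k IH] F G FG /=; first exact: ler_sum.
by apply: IH => x y; apply: ler_sum => ? _; apply: ler_sum.
Qed.

Lemma pathsumZ y0 k c F :
  pathsum y0 k (fun x y => c * F x y) = c * pathsum y0 k F.
Proof.
elim: k F => [|k IH] F /=; first by rewrite mulr_sumr.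
rewrite -IH; congr (pathsum _ _ _); apply/funext => x; apply/funext => y.
by rewrite mulr_sumr; apply: eq_bigr => ? _; rewrite mulr_sumr.
Qed.

(** The cylinders of length [k] cover the space. The induction splits each of them by the next state
    and observation and uses subadditivity. *)
Lemma pr_pathsum y0 k A : measurable A ->
  pr A <= pathsum y0 k (fun x y => pr (A `&` cyl k x y)).
Proof.
move=> mA; have mcyl j x y : measurable (A `&` cyl j x y).
  by apply: measurableI => //; exact: determined_measurable (@cyl_determined _ _ _).
elim: k => [|k /le_trans]; [|apply] => /=.
  apply: (@pr_cover _ _ _ _ _ (fun x => A `&` cyl 0 (fun=> x) (fun=> y0))) => //.
  move=> o Ao; exists (X 0%N o); split=> //; split=> [j|j].
    by rewrite leqn0 => /eqP ->.
  by case: j.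
apply: pathsum_le => x y; rewrite pair_bigA /=.
apply: (@pr_cover _ _ _ _ _
  (fun p => A `&` cyl k.+1 (upd x k.+1 p.1) (upd y k.+1 p.2))) => //.
move=> o [Ao [hx hy]]; exists (X k.+1 o, Y k.+1 o); split=> //=; split=> j.
  rewrite leq_eqVlt => /predU1P[->|jk]; first by rewrite upd_id.
  by rewrite updE// hx.
case/andP=> j0; rewrite leq_eqVlt => /predU1P[->|jk]; first by rewrite upd_id.
by rewrite updE// hy// j0.
Qed.

Definition path_weight k (x : nat -> 'I_N) (y : nat -> 'I_S) : R :=
  pi0 (x 0%N) 0 * \prod_(j < k) (T (x j.+1) (x j) * E (y j.+1) (x j.+1)).

Lemma path_weight_ge0 k x y : 0 <= path_weight k x y.
Proof. by rewrite mulr_ge0// prodr_ge0// => j _; rewrite mulr_ge0. Qed.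

Lemma pr_cyl k x y : pr (cyl k x y) = path_weight k x y.
Proof. by case: hH => _ _ _ _ h; rewrite /fine_pr h. Qed.

(** Summing out the last step first leaves the conditional mean of its factor given the current
    state, at most [b k]; the rest is the same sum for a shorter trajectory. *)
Lemma pathsum_weight y0 k (g : nat -> 'I_N -> 'I_N -> 'I_S -> R) (b : nat -> R) :
  (forall i x x' y, 0 <= g i x x' y) ->
  (forall i x, \sum_x' \sum_y T x' x * E y x' * g i x x' y <= b i) ->
  (forall i, 0 <= b i) ->
  pathsum y0 k (fun x y => path_weight k x y *
     \prod_(i < k) g i (x i) (x i.+1) (y i.+1)) <= \prod_(i < k) b i.
Proof.
move=> g0 gb b0; elim: k => [|k IH] /=.
  have -> : \prod_(i < 0) b i = \sum_x pi0 x 0.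
    by rewrite big_ord0; case: hH => [[_ ->]].
  by apply: ler_sum => x _; rewrite /path_weight !big_ord0 !mulr1.
rewrite big_ord_recr /= mulrC.
apply: le_trans (ler_wpM2l (b0 k) IH).
rewrite -pathsumZ; apply: pathsum_le => x y.
have -> : \sum_x' \sum_y' (path_weight k.+1 (upd x k.+1 x') (upd y k.+1 y') *
    \prod_(i < k.+1) g i (upd x k.+1 x' i) (upd x k.+1 x' i.+1) (upd y k.+1 y' i.+1))
  = (\sum_x' \sum_y' T x' (x k) * E y' x' * g k (x k) x' y') *
    (path_weight k x y * \prod_(i < k) g i (x i) (x i.+1) (y i.+1)).
  rewrite mulr_suml; apply: eq_bigr => x' _.
  rewrite mulr_suml; apply: eq_bigr => y' _.
  rewrite /path_weight !big_ord_recr /= !upd_id !(updE _ _ (ltnSn k)) updE//.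
  have -> : \prod_(i < k) (T (upd x k.+1 x' i.+1) (upd x k.+1 x' i) *
       E (upd y k.+1 y' i.+1) (upd x k.+1 x' i.+1)) =
     \prod_(i < k) (T (x i.+1) (x i) * E (y i.+1) (x i.+1)).
    apply: eq_bigr => i _.
    by rewrite !updE// ltnS// ltnW.
  have -> : \prod_(i < k) g i (upd x k.+1 x' i) (upd x k.+1 x' i.+1) (upd y k.+1 y' i.+1)
    = \prod_(i < k) g i (x i) (x i.+1) (y i.+1).
    apply: eq_bigr => i _.
    by rewrite !updE// ltnS// ltnW.
  ring.
apply: ler_wpM2r => //.
by rewrite mulr_ge0 ?path_weight_ge0// prodr_ge0.
Qed.

(* Markov's inequality for a multiplicative functional of the trajectory; the
   exponential tilt and the indicator of a path are both choices of [g]. *)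
Lemma pr_tilted_bound k (A : set Omega) (g : nat -> 'I_N -> 'I_N -> 'I_S -> R)
    (b : nat -> R) (C : R) :
  determined k A ->
  (forall i x x' y, 0 <= g i x x' y) ->
  (forall i x, \sum_x' \sum_y T x' x * E y x' * g i x x' y <= b i) ->
  (forall i, 0 <= b i) -> 0 <= C ->
  (forall o, A o -> 1 <= C * \prod_(i < k) g i (X i o) (X i.+1 o) (Y i.+1 o)) ->
  pr A <= C * \prod_(i < k) b i.
Proof.
move=> detA g0 gb b0 C0 hA.
(* A point of [A] supplies the element of ['I_S] that [pathsum] takes as the junk observation at
   time 0. *)
have [->|/set0P[t At]] := eqVneq A set0.
  by rewrite pr0 mulr_ge0// prodr_ge0.
have mA := determined_measurable detA.
have mcyl x y : measurable (cyl k x y).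
  exact: determined_measurable (@cyl_determined _ _ _).
apply: le_trans (pr_pathsum (Y 0%N t) k mA) _.
apply: le_trans (ler_wpM2l C0 (pathsum_weight (Y 0%N t) k g0 gb b0)).
rewrite -pathsumZ; apply: pathsum_le => x y.
have G0 : 0 <= \prod_(i < k) g i (x i) (x i.+1) (y i.+1) by exact: prodr_ge0.
(* A cylinder that meets [A] contains a point where the lower bound on the product holds, and the
   product is constant on the cylinder. *)
have [->|/set0P[t' [At' [hx hy]]]] := eqVneq (A `&` cyl k x y) set0.
  by rewrite pr0 mulr_ge0 // mulr_ge0 // path_weight_ge0.
have le1 : pr (A `&` cyl k x y) <= pr (cyl k x y).
  by apply: pr_le => //; exact: measurableI.
apply: le_trans le1 _.
rewrite pr_cyl mulrCA -[leLHS]mulr1 ler_wpM2l ?path_weight_ge0//.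
apply: le_trans (hA _ At') _; rewrite ler_wpM2l// le_eqVlt; apply/orP; left.
apply/eqP/eq_bigr => i _.
by rewrite (hx _ (ltn_ord i)) (hx _ (ltnW (ltn_ord i))) (hy i.+1 (ltn_ord i)).
Qed.

End Paths.

(** * Cumulant generating functions of log-likelihood ratios *)

Section Cumulant.
Context {R : realType} {S : nat}.
Variables p q : 'I_S -> R.
Hypothesis p0 : forall y, 0 < p y.
Hypothesis q0 : forall y, 0 < q y.
Hypothesis p1 : \sum_y p y = 1.
Hypothesis q1 : \sum_y q y = 1.

(** For the log-likelihood ratio ln (p / q) under the law p, these are the moment generating
    function, its logarithm and the mean, which is the relative entropy. [slope] is the slope of the
    chord of [cgf] from the origin, the integrand in [xi]; its value at t = 0 is 0, by division by
    zero. *)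
Definition mgf (t : R) : R := \sum_y p y * (p y / q y) `^ t.
Definition cgf (t : R) : R := ln (mgf t).
Definition kl : R := \sum_y p y * ln (p y / q y).
Definition slope (t : R) : R := cgf t / t.

Let r0 y : 0 < p y / q y. Proof. exact: divr_gt0. Qed.

Lemma mgf_gt0 t : 0 < mgf t.
Proof.
have mgf0 y : 0 <= p y * (p y / q y) `^ t by rewrite mulr_ge0 ?powR_ge0 ?ltW.
rewrite lt_neqAle sumr_ge0 ?andbT// eq_sym.
apply/eqP => /eqP; rewrite psumr_eq0// => /allP h.
have : \sum_y p y = 0.
  apply: big1 => y _; have := h y (mem_index_enum y).
  by rewrite /= mulf_eq0 (gt_eqF (p0 y)) gt_eqF// powR_gt0.
by rewrite p1 => /eqP; rewrite oner_eq0.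
Qed.

(** A concave power lies below its tangent at 1. With v = th ln x, the inequality 1 + u <= exp u is
    used at u = ln x - v and u = - v, and the results are averaged with weights th and 1 - th. *)
Lemma powR_le_affine (x th : R) : 0 < x -> 0 <= th <= 1 ->
  x `^ th <= 1 + th * (x - 1).
Proof.
move=> x0 /andP[th0 th1]; rewrite /powR gt_eqF//.
set v := th * ln x.
have h1 : expR v * (1 + (ln x - v)) <= x.
  rewrite -[leRHS](lnK (_ : x \is Num.pos)) ?posrE//.
  rewrite -{2}(subrK v (ln x)) addrC [ln x - v + v]addrC expRD.
  by rewrite ler_pM2l ?expR_gt0// addrC expR_ge1Dx.
have h2 : expR v * (1 - v) <= 1.
  by rewrite -[leRHS](expRxMexpNx_1 v) ler_pM2l ?expR_gt0// expR_ge1Dx.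
have h3 := ler_wpM2l th0 h1.
have th1' : 0 <= 1 - th by rewrite subr_ge0.
have h4 := ler_wpM2l th1' h2.
have -> : expR v = th * (expR v * (1 + (ln x - v))) + (1 - th) * (expR v * (1 - v)).
  by rewrite /v; ring.
lra.
Qed.

(** Jensen's inequality for the power th: the tangent bound is applied to (p / q)^t / [mgf t], which
    has mean 1. This is convexity of [cgf] along rays from the origin. *)
Lemma cgf_sublinear th t : 0 <= th <= 1 -> cgf (t * th) <= th * cgf t.
Proof.
move=> th01; rewrite /cgf -ln_powR ler_ln ?posrE ?powR_gt0 ?mgf_gt0//.
set m := mgf t; have m0 : 0 < m := mgf_gt0 t.
have -> : mgf (t * th) = m `^ th * \sum_y p y * ((p y / q y) `^ t / m) `^ th.
  have mm : m `^ th * (m^-1) `^ th = 1.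
    by rewrite -powRM ?invr_ge0 ?(ltW m0)// mulfV ?gt_eqF// powR1.
  rewrite mulr_sumr; apply: eq_bigr => y _.
  rewrite powRrM (@powRM _ ((p y / q y) `^ t) m^-1) ?invr_ge0 ?powR_ge0 ?(ltW m0)//.
  by rewrite -[LHS]mulr1 -mm; ring.
rewrite -[leRHS]mulr1 ler_wpM2l ?powR_ge0//.
apply: (@le_trans _ _ (\sum_y p y * (1 + th * ((p y / q y) `^ t / m - 1)))).
  apply: ler_sum => y _; rewrite ler_pM2l// powR_le_affine//.
  by rewrite divr_gt0// powR_gt0.
have -> : \sum_y p y * (1 + th * ((p y / q y) `^ t / m - 1)) =
    (1 - th) * \sum_y p y + th / m * mgf t.
  rewrite !mulr_sumr -big_split; apply: eq_bigr => y _ /=.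
  ring.
by rewrite p1 divfK ?gt_eqF// mulr1 subrK.
Qed.

Lemma ln_le_subr1 (x : R) : 0 < x -> ln x <= x - 1.
Proof. by move=> x0; rewrite -[x in leLHS](subrK 1) addrC le_ln1Dx// ltrBrDr addNr. Qed.

(** Jensen's inequality for ln: [cgf] lies above its tangent at the origin, whose slope is [kl]. *)
Lemma cgf_ge_kl t : t * kl <= cgf t.
Proof.
set m := mgf t; have m0 : 0 < m := mgf_gt0 t.
have h : \sum_y p y * ln ((p y / q y) `^ t / m) <= 0.
  apply: (@le_trans _ _ (\sum_y p y * ((p y / q y) `^ t / m - 1))).
    apply: ler_sum => y _; rewrite ler_pM2l// ln_le_subr1// divr_gt0// powR_gt0//.
  have -> : \sum_y p y * ((p y / q y) `^ t / m - 1) = mgf t / m - \sum_y p y.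
    rewrite mulr_suml -sumrB; apply: eq_bigr => y _; ring.
  by rewrite p1 divff ?gt_eqF// subrr.
rewrite /cgf -subr_le0; apply: le_trans h; rewrite le_eqVlt; apply/orP; left.
apply/eqP; rewrite /kl mulr_sumr -[ln _]mul1r -p1 mulr_suml -sumrB.
apply: eq_bigr => y _; rewrite (@ln_div _ ((p y / q y) `^ t) m) ?posrE ?powR_gt0// ln_powR.
rewrite -/m; ring.
Qed.

(** The tilt with parameter -1 turns p into q, which has total mass 1. *)
Lemma cgfN1 : cgf (-1) = 0.
Proof.
transitivity (ln (\sum_y q y)); last by rewrite q1 ln1.
rewrite /cgf /mgf; congr ln; apply: eq_bigr => y _.
rewrite powR_inv1 ?ltW// invf_div mulrCA divff ?mulr1// gt_eqF//.
Qed.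

Lemma cgf_le0 t : -1 <= t <= 0 -> cgf t <= 0.
Proof.
move=> /andP[t1 t0]; have := @cgf_sublinear (- t) (-1).
rewrite cgfN1 mulr0 mulrNN mul1r; apply; lra.
Qed.

Lemma kl_ge0 : 0 <= kl.
Proof. by have := cgf_ge_kl (-1); rewrite cgfN1 mulN1r oppr_le0. Qed.

Lemma slope_ge0 t : -1 <= t <= 0 -> 0 <= slope t.
Proof.
move=> h; rewrite /slope -mulrNN mulr_ge0// ?oppr_ge0 ?cgf_le0//.
by rewrite invr_le0; case/andP: h.
Qed.

Lemma slope_le_kl t : t <= 0 -> slope t <= kl.
Proof.
rewrite le_eqVlt => /predU1P[->|t0]; first by rewrite /slope invr0 mulr0 kl_ge0.
by rewrite /slope ler_ndivrMr// mulrC cgf_ge_kl.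
Qed.

(** Chord slopes of a convex function increase: u is the fraction u / t of t. *)
Lemma slope_le t u : t <= u -> u < 0 -> slope t <= slope u.
Proof.
move=> tu u0; have t0 : t < 0 by apply: le_lt_trans u0.
rewrite /slope ler_ndivlMr// mulrAC -mulrA mulrC.
have := @cgf_sublinear (u / t) t; rewrite mulrCA divff ?lt_eqF// mulr1.
apply; rewrite ler_ndivlMr// ler_ndivrMr// mul0r mul1r; lra.
Qed.

(** At -1/2 [mgf] is the Bhattacharyya coefficient, that is 1 minus half the sum of the squares of
    sqrt p - sqrt q. *)
Lemma cgf_half_lt0 : (exists y, p y != q y) -> cgf (- 2^-1) < 0.
Proof.
case=> y0 pq; have mpos := mgf_gt0 (- 2^-1).
rewrite /cgf -[X in _ < X](ln1 R) ltr_ln ?posrE//.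
pose w y := (p y / q y) `^ (- 2^-1).
have w2 y : p y * w y ^+ 2 = q y.
  rewrite -powR_mulrn ?powR_ge0// -powRrM mulNr mulVf ?pnatr_eq0//.
  by rewrite powR_inv1 ?ltW// invf_div mulrCA divff ?mulr1// gt_eqF.
have -> : mgf (- 2^-1) = 1 - 2^-1 * \sum_y p y * (1 - w y) ^+ 2.
  transitivity (2^-1 * (\sum_y p y + \sum_y q y) - 2^-1 * \sum_y p y * (1 - w y) ^+ 2).
    rewrite -big_split -mulrBr -sumrB mulr_sumr; apply: eq_bigr => y _ /=.
    by rewrite -/(w y) -w2; field.
  by rewrite p1 q1; field.
rewrite gtrBl mulr_gt0 ?invr_gt0//.
have t0 y : 0 <= p y * (1 - w y) ^+ 2 by rewrite mulr_ge0 ?sqr_ge0 ?ltW.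
rewrite lt_neqAle sumr_ge0 ?andbT// eq_sym psumr_eq0//.
apply: contra pq => /allP/(_ y0 (mem_index_enum y0)) /=.
rewrite mulf_eq0 gt_eqF//= sqrf_eq0 subr_eq0 => /eqP w1.
by rewrite -w2 -w1 expr1n mulr1.
Qed.

Lemma slope_measurable (a b : R) : b <= 0 -> measurable_fun `[a, b] slope.
Proof.
move=> b0; apply: (eq_measurable_fun (fun t => cgf t * - ((- t) `^ (-1)))).
  move=> t; rewrite inE/= in_itv/= => /andP[_ tb].
  have t0 : t <= 0 := le_trans tb b0.
  by rewrite /slope powR_inv1 ?oppr_ge0// invrN opprK.
apply: measurable_funTS; apply: measurable_funM.
  apply: measurableT_comp; first exact: measurable_ln.
  apply: measurable_sum => y; apply: measurable_funM => //.
  exact: measurable_powRr.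
have h := measurableT_comp (@measurable_powR R (-1)) (@oppr_measurable _ setT).
exact: (measurable_funN h).
Qed.

Lemma slope_integrable (a b : R) : -1 <= a -> b <= 0 ->
  lebesgue_measure.-integrable `[a, b] (EFin \o slope).
Proof.
move=> a1 b0; apply: measurable_bounded_integrable => //.
- by rewrite /= lebesgue_measure_itv; case: ifP; rewrite ?ltry.
- exact: slope_measurable.
- exists kl; split; first exact: num_real.
  move=> x klx t /=; rewrite in_itv/= => /andP[at_ tb].
  have t0 : t <= 0 := le_trans tb b0.
  rewrite ger0_norm ?slope_ge0 ?(le_trans a1 at_)//.
  exact: le_trans (slope_le_kl t0) (ltW klx).
Qed.

Definition slope_int (a b : R) : R := \int[lebesgue_measure]_(t in `[a, b]) slope t.

Lemma slope_int_cat a b e : -1 <= a -> a <= b -> b <= e -> e <= 0 ->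
  slope_int a e = slope_int a b + slope_int b e.
Proof.
move=> a1 ab be e0.
have ia := slope_integrable a1 e0.
have := @Rintegral_itvB R slope (BLeft a) (BRight e) b ia.
rewrite !bnd_simp => /(_ ab be).
rewrite Rintegral_itv_obnd_cbnd//.
  by rewrite /slope_int => <-; rewrite addrC subrK.
by apply: integrableS ia => //; apply: subset_itvr; rewrite bnd_simp.
Qed.

Lemma itv_length (a b : R) : a <= b -> fine (lebesgue_measure `[a, b]) = b - a :> R.
Proof.
rewrite le_eqVlt lebesgue_measure_itv /= => /predU1P[->|ab].
  by rewrite lte_fin ltxx subrr.
by rewrite lte_fin ab.
Qed.

Lemma cst_integrable (u a b : R) :
  lebesgue_measure.-integrable `[a, b] (EFin \o (fun=> u)).
Proof.
apply: measurable_bounded_integrable => //.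
  by rewrite /= lebesgue_measure_itv; case: ifP; rewrite ?ltry.
by exists `|u|; split=> // x ux t _; exact: ltW.
Qed.

Lemma slope_int_le a b u : -1 <= a -> a <= b -> b <= 0 ->
  (forall t, a <= t <= b -> slope t <= u) -> slope_int a b <= u * (b - a).
Proof.
move=> a1 ab b0 h; rewrite -(itv_length ab) -Rintegral_cst//.
apply: le_Rintegral => //; first exact: slope_integrable.
exact: cst_integrable.
Qed.

Lemma slope_int_ge a b u : -1 <= a -> a <= b -> b <= 0 ->
  (forall t, a <= t <= b -> u <= slope t) -> u * (b - a) <= slope_int a b.
Proof.
move=> a1 ab b0 h; rewrite -(itv_length ab) -Rintegral_cst//.
apply: le_Rintegral => //; last exact: slope_integrable.
exact: cst_integrable.
Qed.

Lemma slope_int_ge0 a b : -1 <= a -> a <= b -> b <= 0 -> 0 <= slope_int a b.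
Proof.
move=> a1 ab b0; rewrite -[leLHS](mul0r (b - a)); apply: slope_int_ge => //.
by move=> t /andP[at_ tb]; rewrite slope_ge0// (le_trans a1 at_) (le_trans tb b0).
Qed.

(** The middle piece [- c/2, - c/4] lies to the right of -1/2, so [slope] is there at least its
    positive value at -1/2; the piece also stays away from 0, where [slope] takes its default
    value. *)
Lemma slope_int_gt0 c : 0 < c -> c <= 1 -> (exists y, p y != q y) ->
  0 < slope_int (- c) 0.
Proof.
move=> c0 c1 pq.
have s0 : 0 < slope (- 2^-1).
  by rewrite /slope -mulrNN mulr_gt0// ?oppr_gt0 ?cgf_half_lt0// invrN oppr_lt0 !invr_gt0.
rewrite (@slope_int_cat _ (- (c / 2))); [|lra..].
rewrite (@slope_int_cat (- (c / 2)) (- (c / 4))); [|lra..].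
have h1 : 0 <= slope_int (- c) (- (c / 2)) by apply: slope_int_ge0; lra.
have h2 : 0 <= slope_int (- (c / 4)) 0 by apply: slope_int_ge0; lra.
have h3 : slope (- 2^-1) * (- (c / 4) - - (c / 2)) <= slope_int (- (c / 2)) (- (c / 4)).
  by apply: slope_int_ge => [||| t /andP[t1 t2]]; [lra..|apply: slope_le; lra].
have h4 : 0 < slope (- 2^-1) * (- (c / 4) - - (c / 2)) by apply: mulr_gt0 => //; lra.
lra.
Qed.

(** On each cell of the geometric grid the increasing function [slope] is at most its value at the
    right end. *)
Lemma slope_int_geometric (s0 rho : R) I : 0 < s0 -> s0 <= 1 -> 0 < rho -> rho <= 1 ->
  slope_int (- s0) (- (s0 * rho ^+ I)) <=
  \sum_(i < I) slope (- (s0 * rho ^+ i.+1)) * (s0 * rho ^+ i - s0 * rho ^+ i.+1).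
Proof.
move=> s00 s01 r0' r1.
have le1 i : s0 * rho ^+ i <= s0 by rewrite ger_pMr// exprn_ile1// ltW.
have gt0 i : 0 < s0 * rho ^+ i by rewrite mulr_gt0// exprn_gt0.
have leS i : s0 * rho ^+ i.+1 <= s0 * rho ^+ i.
  by rewrite exprS mulrCA ger_pMl.
elim: I => [|I IH].
  rewrite big_ord0 expr0 mulr1 -[leRHS](mul0r (- s0 - - s0)) subrr mulr0.
  apply: (@le_trans _ _ (kl * (- s0 - - s0))); last by rewrite subrr mulr0.
  by apply: slope_int_le => [||| t /andP[_ ts]]; [lra..|apply: slope_le_kl; lra].
rewrite big_ord_recr /= (@slope_int_cat _ (- (s0 * rho ^+ I))); last 4 first.
- lra.
- by rewrite lerN2.
- by rewrite lerN2.
- by rewrite oppr_le0 ltW.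
apply: lerD => //.
have -> : s0 * rho ^+ I - s0 * rho ^+ I.+1 =
  - (s0 * rho ^+ I.+1) - - (s0 * rho ^+ I) by ring.
apply: slope_int_le => [||| t /andP[t1 t2]].
- by have := le1 I; lra.
- by rewrite lerN2.
- by rewrite oppr_le0 ltW.
- by apply: slope_le => //; rewrite oppr_lt0.
Qed.

Lemma bernoulli_ineq (delta : R) n : 0 <= delta <= 1 -> 1 - n%:R * delta <= (1 - delta) ^+ n.
Proof.
move=> /andP[d0 d1]; elim: n => [|n IH]; first by rewrite mul0r subr0 expr0.
rewrite exprS; have h0 : 0 <= 1 - delta by lra.
apply: le_trans (ler_wpM2l h0 IH).
have : 0 <= n%:R * delta * delta by rewrite !mulr_ge0.
by rewrite -natr1; lra.
Qed.

(* A lower Riemann sum of the monotone function [slope] on the geometric grid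
   [c (1 - delta) ^ (n + M i)], multiplied by the grid ratio. *)
Lemma cgf_grid_sum (M I n : nat) (c delta alpha : R) :
  c = M%:R^-1 -> (n < M)%N -> 0 < delta < 1 ->
  (1 - delta) ^+ (M * I) <= expR (- alpha) ->
  delta * \sum_(i < I.+1) cgf (- (c * (1 - delta) ^+ (n + M * i))) <=
  - (c * slope_int (- c) 0) + c ^+ 2 * expR (- alpha) * kl +
  delta * (slope_int (- c) 0 + c * kl).
Proof.
move=> cE nM /andP[d0 d1] hI.
have M0 : (0 < M)%N by apply: leq_trans nM.
have MR0 : 0 < M%:R :> R by rewrite ltr0n.
have c0 : 0 < c by rewrite cE invr_gt0.
have c1 : c <= 1 by rewrite cE invf_le1// ler1n.
have cM : c * M%:R = 1 by rewrite cE mulVf// gt_eqF.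
have b0 : 0 < 1 - delta by lra.
have b1 : 1 - delta <= 1 by lra.
set s0 := c * (1 - delta) ^+ n; set rho := (1 - delta) ^+ M.
have s00 : 0 < s0 by rewrite mulr_gt0// exprn_gt0.
have s0c : s0 <= c by rewrite ger_pMr// exprn_ile1// ltW.
have rho0 : 0 < rho by rewrite exprn_gt0.
have rho1 : rho <= 1 by rewrite exprn_ile1// ltW.
have rhoM : 1 - M%:R * delta <= rho by apply: bernoulli_ineq; lra.
set s := fun i => s0 * rho ^+ i.
have sE i : c * (1 - delta) ^+ (n + M * i) = s i.
  by rewrite /s /s0 /rho exprD exprM mulrA.
have sgt0 i : 0 < s i by rewrite mulr_gt0// exprn_gt0.
have sle i : s i <= s0 by rewrite ger_pMr// exprn_ile1// ltW.
have sS i : s i.+1 = rho * s i by rewrite /s exprS mulrCA.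
have slope_s i : 0 <= slope (- s i).
  by apply: slope_ge0; have := sle i; have := sgt0 i; lra.
set J := slope_int (- c) 0.
have J0 : 0 <= J by apply: slope_int_ge0; lra.
pose A := \sum_(i < I) slope (- s i.+1) * (s i - s i.+1).
have cgfE i : cgf (- s i) = - (slope (- s i) * s i).
  by rewrite /slope -[RHS]mulrN divfK// oppr_eq0 gt_eqF.
have hA : delta * \sum_(i < I.+1) cgf (- (c * (1 - delta) ^+ (n + M * i))) <=
    - (c * (rho * A)).
  (* The term i = 0 is nonpositive and is dropped; term i + 1 is matched with the cell between
     [s i.+1] and [s i]. *)
  rewrite big_ord_recl /= mulrDr -[leRHS]add0r; apply: lerD.
    rewrite sE cgfE mulrN oppr_le0; apply: mulr_ge0; first exact: ltW.
    by apply: mulr_ge0 => //; exact: ltW.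
  rewrite /A !mulr_sumr -sumrN; apply: ler_sum => i _.
  rewrite sE cgfE /bump leq0n add1n mulrN lerN2.
  (* Bernoulli's inequality gives 1 - rho <= M delta, and c M = 1, so c times the relative cell
     length 1 - rho is at most delta. *)
  have h : c * (rho * (s i - s i.+1)) <= delta * s i.+1.
    have e : c * (1 - rho) <= delta.
      rewrite -[leRHS]mul1r -cM -mulrA ler_pM2l//; lra.
    have := mulr_ge0 (ltW (mulr_gt0 rho0 (sgt0 i))) (_ : 0 <= delta - c * (1 - rho)).
    rewrite subr_ge0 sS => /(_ e); lra.
  have := ler_wpM2l (slope_s i.+1) h; lra.
(* The grid covers only [- s0, - s I]. The integral over either missing end piece is at most [kl]
   times its length; these lengths are bounded in [h1] and [h2]. *)
have hG : J - kl * s I - kl * (c - s0) <= A.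
  have := slope_int_geometric I s00 (le_trans s0c c1) rho0 rho1.
  rewrite -/A -/(s I) => h.
  have sI := sgt0 I; have sI' := sle I.
  have e : J = slope_int (- c) (- s0) + slope_int (- s0) (- s I) + slope_int (- s I) 0.
    by rewrite -slope_int_cat ?lerN2//; [rewrite -slope_int_cat//|..]; lra.
  have h1 : slope_int (- c) (- s0) <= kl * (- s0 - - c).
    by apply: slope_int_le => [||| t /andP[_ t1]]; [lra..|apply: slope_le_kl; lra].
  have h2 : slope_int (- s I) 0 <= kl * (0 - - s I).
    by apply: slope_int_le => [||| t /andP[_ t1]]; [lra..|apply: slope_le_kl; lra].
  lra.
have h1 : s I <= c * expR (- alpha).
  rewrite -sE exprD mulrCA; apply: le_trans (_ : 1 * (c * (1 - delta) ^+ (M * I)) <= _).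
    rewrite ler_pM2r; first by rewrite exprn_ile1// ltW.
    by rewrite mulr_gt0// exprn_gt0.
  by rewrite mul1r ler_pM2l.
have h2 : c - s0 <= delta.
  have hb : 1 - n%:R * delta <= (1 - delta) ^+ n by apply: bernoulli_ineq; lra.
  have h3 : c * (1 - n%:R * delta) <= s0 by rewrite ler_pM2l.
  have h4 : c * n%:R <= 1 by rewrite -[leRHS]cM ler_pM2l// ler_nat ltnW.
  have := ler_wpM2r (ltW d0) h4; lra.
have k0 := kl_ge0.
have hB : J - M%:R * delta * J - kl * (c * expR (- alpha) + delta) <= rho * A.
  apply: le_trans (ler_wpM2l (ltW rho0) hG).
  have k1 : kl * (s I + (c - s0)) <= kl * (c * expR (- alpha) + delta).
    by apply: ler_wpM2l => //; lra.
  have k2 : 0 <= kl * (s I + (c - s0)).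
    by apply: mulr_ge0 => //; have := sgt0 I; lra.
  have k3 := ler_wpM2r k2 rho1.
  have k4 := ler_wpM2r J0 rhoM.
  lra.
apply: le_trans hA _.
have := ler_wpM2l (ltW c0) hB.
have -> : c * (J - M%:R * delta * J - kl * (c * expR (- alpha) + delta)) =
  c * J - (c * M%:R) * delta * J - kl * (c * (c * expR (- alpha) + delta)) by ring.
rewrite cM; lra.
Qed.

End Cumulant.

(** * Deterministic dynamics and the logit filter *)

Section Back.
Context {m : nat}.
Variables (sigma : 'S_m).

Lemma back0 a : back sigma 0 a = a.
Proof. by rewrite /back expg0 invg1 perm1. Qed.

Lemma backS n a : back sigma n.+1 a = back sigma n ((sigma^-1)%g a).
Proof. by rewrite /back expgSr invMg permM. Qed.

Lemma backK n a : back sigma n ((sigma ^+ n)%g a) = a.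
Proof. by rewrite /back permK. Qed.

Lemma back_periodic M n i a : (sigma ^+ M = 1)%g -> back sigma (n + M * i) a = back sigma n a.
Proof. by move=> h; rewrite /back expgD expgM h expg1n mulg1. Qed.

Lemma back_iter j l a : back sigma j ((sigma ^+ (l + j))%g a) = (sigma ^+ l)%g a.
Proof. by rewrite expgD permM backK. Qed.

End Back.

Section Dynamics.
Context {R : realType} {m r : nat}.
Variables (P : 'M[R]_m) (D12 : 'M[R]_(m, r)) (D22 : 'M[R]_r).
Variables (nu : 'I_(m + r) -> 'I_(m + r)) (sigma : 'S_m).
Hypothesis hcol : forall j, col j (block_mx P D12 0 D22) = basis_vec (nu j).
Hypothesis hsigma : forall x, P *m basis_vec x = basis_vec (sigma x).

Lemma DE i j : block_mx P D12 0 D22 i j = (i == nu j)%:R.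
Proof. by have /matrixP/(_ i 0) := hcol j; rewrite !mxE eqxx andbT. Qed.

Lemma PE i x : P i x = (i == sigma x)%:R.
Proof. by have /matrixP/(_ i 0) := hsigma x; rewrite -colE !mxE eqxx andbT. Qed.

Lemma perm_mx_pow k x : P ^+ k *m basis_vec x = basis_vec ((sigma ^+ k)%g x).
Proof.
elim: k x => [|k IH] x; first by rewrite expr0 mul1mx expg0 perm1.
by rewrite exprS -mulmxA IH hsigma expgSr permM.
Qed.

Lemma basis_vec_inj n : injective (@basis_vec R n).
Proof.
move=> x y /matrixP/(_ x 0); rewrite !mxE !eqxx andbT /=.
by case: eqVneq => // _ /eqP; rewrite oner_eq0.
Qed.

Lemma perm_order M : P ^+ M = 1%:M -> (sigma ^+ M = 1)%g.
Proof.
move=> h; apply/permP => x; rewrite perm1; apply: basis_vec_inj.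
by rewrite -perm_mx_pow h mul1mx.
Qed.

Lemma nu_recurrent x : nu (lshift r x) = lshift r (sigma x).
Proof.
have := DE (lshift r (sigma x)) (lshift r x).
rewrite block_mxEul PE eqxx; case: eqVneq => // _ /eqP.
by rewrite oner_eq0.
Qed.

Lemma nu_iter_recurrent l x : iter l nu (lshift r x) = lshift r ((sigma ^+ l)%g x).
Proof.
elim: l => [|l IH]; first by rewrite expg0 perm1.
by rewrite /= IH nu_recurrent expgSr permM.
Qed.

(** Recurrent states are never left, so an orbit that is transient at time [k] has been transient
    throughout and is driven by [D22] alone. *)
Lemma nu_iter_transient k b b' : iter k nu (rshift m b) = rshift m b' ->
  D22 ^+ k *m basis_vec b = basis_vec b'.
Proof.
elim: k b' => [|k IH] b' /=.
  by move/rshift_inj ->; rewrite expr0 mul1mx.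
case: (split_ordP (iter k nu (rshift m b))) => [a ->|c e].
  by rewrite nu_recurrent => /eqP; rewrite eq_lrshift.
rewrite e => h; rewrite exprS -mulmxA (IH _ e); apply/colP => i.
rewrite -colE !mxE andbT -(block_mxEdr P D12 0 D22 i c) DE h.
by rewrite (inj_eq (@rshift_inj _ _)).
Qed.

(** An orbit still transient after [k] steps would make [D22 ^+ k] send a basis vector to a basis
    vector. *)
Lemma nu_iter_nilpotent k : D22 ^+ k = 0 -> forall j, exists a, iter k nu j = lshift r a.
Proof.
move=> h j; case: (split_ordP (iter k nu j)) => [a ->|b e]; first by exists a.
exfalso; case: (split_ordP j) e => [a ->|c -> e].
  by rewrite nu_iter_recurrent => /eqP; rewrite eq_lrshift.
have := nu_iter_transient e; rewrite h mul0mx => /matrixP/(_ b 0).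
by rewrite !mxE !eqxx => /esym/eqP; rewrite oner_eq0.
Qed.

End Dynamics.

(** * The finite part of the logit filter *)

Section RecurrentFilter.
Context {R : realType} {m S : nat}.
Variables (Et : 'M[R]_(S, m)) (sigma : 'S_m) (wt0 : 'cV[R]_m).
Variables (delta : R) (y : nat -> 'I_S).

(* On the recurrent states the logit filter stays finite and decouples from the
   transient entries, which remain [-oo]. *)
Fixpoint rec_filter (k : nat) : 'I_m -> R :=
  if k is k'.+1 then
    fun a => (1 - delta) * rec_filter k' ((sigma^-1)%g a) + delta * ln (Et (y k) a)
  else fun a => wt0 a 0.

Lemma rec_filter_unroll k0 K a : rec_filter (k0 + K) a =
  (1 - delta) ^+ K * rec_filter k0 (back sigma K a) +
  \sum_(j < K) delta * (1 - delta) ^+ j * ln (Et (y (k0 + K - j)) (back sigma j a)).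
Proof.
elim: K a => [|K IH] a; first by rewrite big_ord0 addr0 expr0 mul1r addn0 back0.
rewrite addnS /= IH big_ord_recl /= subn0 expr0 mulr1 back0.
rewrite mulrDr mulrA -exprS -backS -!addrA; congr (_ + _).
rewrite addrC; congr (_ + _); rewrite mulr_sumr; apply: eq_bigr => j _.
by rewrite /bump leq0n add1n subSS exprS backS; ring.
Qed.

Hypothesis d01 : 0 < delta < 1.

Lemma Wconst_wt0 a : `|wt0 a 0| <= Wconst Et wt0.
Proof.
rewrite /Wconst le_max; apply/orP; left.
rewrite [leRHS]/Num.norm/= mx_normrE; exact: (le_bigmax _ _ (a, 0)).
Qed.

Lemma Wconst_ln i a : `|ln (Et i a)| <= Wconst Et wt0.
Proof.
rewrite /Wconst le_max; apply/orP; right.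
apply: le_trans (le_bigmax _ _ i).
have -> : ln (Et i a) = map_mx (@ln R) (Et^T *m basis_vec i) a 0.
  by rewrite -colE !mxE.
rewrite [leRHS]/Num.norm/= mx_normrE; exact: (le_bigmax _ _ (a, 0)).
Qed.

(** Each update is a convex combination of an earlier value and a log-likelihood, both bounded by
    [Wconst]. *)
Lemma rec_filter_bound k a : `|rec_filter k a| <= Wconst Et wt0.
Proof.
have /andP[d0 d1] := d01.
elim: k a => [|k IH] a; first exact: Wconst_wt0.
apply: le_trans (ler_normD _ _) _; rewrite !normrM.
have d1' : 0 <= 1 - delta by lra.
rewrite (ger0_norm d1') (gtr0_norm d0).
have := ler_wpM2l d1' (IH ((sigma^-1)%g a)).
have := ler_wpM2l (ltW d0) (Wconst_ln (y k.+1) a).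
by move=> /=; lra.
Qed.

End RecurrentFilter.

Section Filter.
Context {R : realType} {m r S : nat}.
Variables (P : 'M[R]_m) (sigma : 'S_m) (E : 'M[R]_(S, m + r)).
Variables (wt0 : 'cV[R]_m) (delta : R) (y : nat -> 'I_S).
Hypothesis hsigma : forall x, P *m basis_vec x = basis_vec (sigma x).
Hypothesis hE : forall y x, 0 < lsubmx E y x.
Hypothesis d01 : 0 < delta < 1.

Notation w := (logit_filter (block_mx P 0 0 1%:M) E delta
  (col_mx (map_mx (@EFin R) wt0) (const_mx (-oo)%E)) y).

(** The zero blocks annihilate infinite entries since 0 times -oo is 0, while the identity block
    carries -oo forward and any further summand leaves it at -oo. *)
Lemma logit_filterE k :
  (forall a, w k (lshift r a) 0 = (rec_filter (lsubmx E) sigma wt0 delta y k a)%:E) /\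
  (forall b, w k (rshift m b) 0 = -oo%E).
Proof.
have /andP[d0 d1] := d01.
elim: k => [|k [IHl IHr]] /=.
  by split=> a; rewrite ?col_mxEu ?col_mxEd !mxE.
split=> [a|b]; rewrite !mxE big_split_ord /=.
  rewrite [X in (_ + X + _)%E]big1 ?adde0; last first.
    by move=> j _; rewrite block_mxEur !mxE mul0e.
  rewrite (bigD1 ((sigma^-1)%g a)) //= big1 ?adde0; last first.
    move=> j ja; rewrite block_mxEul (PE hsigma) !mxE.
    case: eqVneq => [aj|]; last by rewrite mul0e.
    by move: ja; rewrite aj permK eqxx.
  rewrite block_mxEul (PE hsigma) permKV eqxx mul1e !mxE IHl.
  have -> : \sum_j E^T (lshift r a) j * basis_vec (y k.+1) j 0 = lsubmx E (y k.+1) a.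
    rewrite (bigD1 (y k.+1)) //= big1 ?addr0 ?mxE ?eqxx ?mulr1//.
    by move=> j /negPf jy; rewrite !mxE jy mulr0.
  by rewrite leNgt hE /= -!EFinM -EFinD mxE.
rewrite big1 ?add0e; last by move=> j _; rewrite block_mxEdl !mxE mul0e.
rewrite (bigD1 b) //= big1 ?adde0; last first.
  by move=> j jb; rewrite block_mxEdr !mxE eq_sym (negPf jb) mul0e.
by rewrite block_mxEdr !mxE eqxx mul1e IHr gt0_muleNy ?lte_fin ?subr_gt0.
Qed.

Lemma filter_error k a : argmax (w k) != [set lshift r a]%SET ->
  exists2 b, b != a & rec_filter (lsubmx E) sigma wt0 delta y k a <=
                      rec_filter (lsubmx E) sigma wt0 delta y k b.
Proof.
have [hl hr] := logit_filterE k.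
move=> err; apply: contrapT => nob; move/eqP: err; apply.
have lt b : b != a -> rec_filter (lsubmx E) sigma wt0 delta y k b <
    rec_filter (lsubmx E) sigma wt0 delta y k a.
  by move=> ba; rewrite ltNge; apply/negP => h; apply: nob; exists b.
apply/setP => z; rewrite !inE; apply/forallP/eqP => [h|-> x'].
  case: (split_ordP z) h => [b ->|b ->] /(_ (lshift r a)).
    rewrite !hl lee_fin; case: (eqVneq b a) => [->//|/lt].
    by rewrite ltNge => /negPf ->.
  by rewrite hl hr.
case: (split_ordP x') => [b ->|b ->]; rewrite ?hl ?hr ?leNye//.
by rewrite lee_fin; case: (eqVneq b a) => [->//|/lt/ltW].
Qed.

End Filter.

(** * Switches and confusions *)

Section Switch.
Context {R : realType} {N S : nat}.
Variables (H : hmm_process R N S) (pi0 : 'cV[R]_N) (T : 'M[R]_N).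
Variables (E : 'M[R]_(S, N)).
Hypothesis hH : is_hmm H pi0 T E.
Notation X := (@state R N S H).
Notation Y := (@obs R N S H).
Notation pr := (fine_pr (hmm_prob H)).

Lemma emission_sum1 x : \sum_y E y x = 1.
Proof. by case: hH => _ _ [_ ->]. Qed.

Lemma transition_sum1 x : \sum_x' T x' x = 1.
Proof. by case: hH => _ [_ ->]. Qed.

Lemma transition_ge0 x' x : 0 <= T x' x.
Proof. by case: hH => _ [h _]. Qed.

Lemma transition_le1 x' x : T x' x <= 1.
Proof.
rewrite -(transition_sum1 x) (bigD1 x') //= lerDl sumr_ge0// => z _.
exact: transition_ge0.
Qed.

Lemma switch_determined (nu : 'I_N -> 'I_N) i k : (i < k)%N ->
  determined k [set o | X i.+1 o != nu (X i o)].
Proof. by move=> ik t t' eX _ /=; rewrite !eX// ltnW. Qed.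

Lemma pr_switch (nu : 'I_N -> 'I_N) (b : R) i k : (i < k)%N -> 0 <= b ->
  (forall x, 1 - T (nu x) x <= b) ->
  pr [set o | X i.+1 o != nu (X i o)] <= b.
Proof.
move=> ik b0 hb.
(* The functional is the indicator of a deviation at step [i] and is 1 at all other steps, so its
   product over the trajectory is the indicator of the event. *)
pose g j (x x' : 'I_N) (_ : 'I_S) : R := if j == i then (x' != nu x)%:R else 1.
pose bb j : R := if j == i then b else 1.
have prodE (F : nat -> R) : (forall j, j != i -> F j = 1) -> \prod_(j < k) F j = F i.
  move=> h; rewrite (bigD1 (Ordinal ik)) //= big1 ?mulr1// => j ji.
  exact: h.
rewrite -[leRHS]mul1r.
have -> : b = \prod_(j < k) bb j.
  by rewrite prodE /bb ?eqxx// => j /negPf ->.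
apply: (@pr_tilted_bound _ _ _ _ _ _ _ hH k _ g).
- exact: switch_determined.
- by move=> j x x' y; rewrite /g; case: ifP.
- move=> j x; rewrite /g /bb.
  have e x' (c : R) : \sum_y T x' x * E y x' * c = T x' x * c.
    by rewrite -mulr_suml -mulr_sumr emission_sum1 mulr1.
  case: ifP => _; under eq_bigr do rewrite e; last first.
    by rewrite -mulr_suml transition_sum1 mulr1.
  apply: le_trans (hb x).
  apply: (@le_trans _ _ (\sum_x' T x' x - T (nu x) x)); last by rewrite transition_sum1.
  rewrite (bigD1 (nu x)) //=.
  rewrite [in leRHS](bigD1 (nu x)) //= eqxx /= mulr0 add0r addrAC subrr add0r.
  by apply: ler_sum => z zn; rewrite zn mulr1.
- by move=> j; rewrite /bb; case: ifP.
- by [].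
- move=> t /= ht; rewrite mul1r (prodE (fun j => g j (X j t) (X j.+1 t) (Y j.+1 t))).
    by rewrite /g eqxx ht.
  by move=> j /negPf ji; rewrite /g ji.
Qed.

End Switch.

(** * Chernoff's bound for the confusion of two recurrent states *)

Section Chernoff.
Context {R : realType} {m r S : nat}.
Variables (H : hmm_process R (m + r) S) (pi0 : 'cV[R]_(m + r)).
Variables (T : 'M[R]_(m + r)) (E : 'M[R]_(S, m + r)).
Variables (sigma : 'S_m) (wt0 : 'cV[R]_m) (delta c : R).
Hypothesis hH : is_hmm H pi0 T E.
Hypothesis hE : forall y x, 0 < lsubmx E y x.
Hypothesis d01 : 0 < delta < 1.
Hypothesis c0 : 0 < c.
Notation X := (@state R (m + r) S H).
Notation Y := (@obs R (m + r) S H).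
Notation pr := (fine_pr (hmm_prob H)).
Notation Et := (lsubmx E).
Notation W := (Wconst Et wt0).
Notation back := (back sigma).
Notation rf k o := (rec_filter Et sigma wt0 delta (fun j => Y j o) k).

Definition step_cgf (x' x : 'I_m) (j : nat) : R -> R :=
  cgf (Et ^~ (back j x')) (Et ^~ (back j x)).

Lemma Et_sum1 a : \sum_y Et y a = 1.
Proof.
by rewrite -(emission_sum1 hH (lshift r a)); apply: eq_bigr => y _; rewrite mxE.
Qed.

(** The orbit is read backwards from the final state [x']. The [K] prescribed states, at times k0 +
    1 to k0 + K, are those that emit the observations in the unrolled filter. *)
Definition confusion (k0 K : nat) (x' x : 'I_m) : set (hmm_space H) :=
  [set o | (forall j, (j < K)%N -> X (k0 + K - j)%N o = lshift r (back j x')) /\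
           rf (k0 + K)%N o x' <= rf (k0 + K)%N o x].

Lemma rec_filter_obs k y y' : (forall j, (1 <= j <= k)%N -> y j = y' j) ->
  rec_filter Et sigma wt0 delta y k = rec_filter Et sigma wt0 delta y' k.
Proof.
elim: k => //= k IH h; rewrite IH; last by move=> j /andP[j0 jk]; rewrite h// j0 ltnW.
by rewrite h ?leqnn.
Qed.

Lemma confusion_determined k0 K x' x : determined (k0 + K) (confusion k0 K x' x).
Proof.
move=> t t' eX eY [h1 h2]; split=> [j jK|].
  by rewrite -eX ?leq_subr// h1.
by rewrite -(rec_filter_obs eY).
Qed.

Lemma pr_confusion k0 K x' x : pr (confusion k0 K x' x) <=
  expR (c / delta * (2 * W * (1 - delta) ^+ K) +
        \sum_(j < K) step_cgf x' x j (- (c * (1 - delta) ^+ j))).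
Proof.
have /andP[d0 d1] := d01.
(* [s j] is the Chernoff parameter c / delta times the filter weight at lag j, [L j] the
   log-likelihood ratio at that lag, and [ag i] the lag of the step from i to i + 1. The functional
   [g] both tilts and confines the trajectory to the prescribed states. *)
pose s j := c * (1 - delta) ^+ j.
pose L j y := ln (Et y (back j x')) - ln (Et y (back j x)).
pose ag i := (k0 + K - i.+1)%N.
pose g i (_ z : 'I_(m + r)) (y : 'I_S) : R := if (i < k0)%N then 1 else
  (z == lshift r (back (ag i) x'))%:R * expR (- (s (ag i) * L (ag i) y)).
pose b i : R := if (i < k0)%N then 1 else expR (step_cgf x' x (ag i) (- s (ag i))).
have prodE (F : nat -> R) : (forall i, (i < k0)%N -> F i = 1) ->
    \prod_(i < k0 + K) F i = \prod_(j < K) F (k0 + K - j.+1)%N.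
  move=> h; rewrite big_split_ord /= big1 ?mul1r; last by move=> i _; apply: h.
  rewrite (reindex_inj rev_ord_inj) /=; apply: eq_bigr => j _.
  by rewrite addnBA.
have agE j : (j < K)%N -> ag (k0 + K - j.+1)%N = j by rewrite /ag => jK; lia.
have geE j : (j < K)%N -> (k0 + K - j.+1 < k0)%N = false.
  by move=> jK; apply/negP; lia.
have SE j : (j < K)%N -> (k0 + K - j.+1).+1 = (k0 + K - j)%N by move=> jK; lia.
have -> : expR (c / delta * (2 * W * (1 - delta) ^+ K) +
        \sum_(j < K) step_cgf x' x j (- (c * (1 - delta) ^+ j))) =
   expR (c / delta * (2 * W * (1 - delta) ^+ K)) * \prod_(i < k0 + K) b i.
  rewrite expRD expR_sum; congr (_ * _); rewrite prodE; last first.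
    by move=> i ik; rewrite /b ik.
  by apply: eq_bigr => j _; rewrite /b (geE _ (ltn_ord j)) (agE _ (ltn_ord j)).
apply: (@pr_tilted_bound _ _ _ _ _ _ _ hH _ _ g).
- exact: confusion_determined.
- by move=> i z z' y; rewrite /g; case: ifP => // _; rewrite mulr_ge0// expR_ge0.
- move=> i z; rewrite /g /b; case: ifP => ik.
    under eq_bigr do under eq_bigr do rewrite mulr1.
    under eq_bigr do rewrite -mulr_sumr (emission_sum1 hH) mulr1.
    by rewrite (transition_sum1 hH).
  (* Only the prescribed next state survives. Its transition probability is bounded by 1, and the
     sum over observations is [mgf] at - s. *)
  rewrite (bigD1 (lshift r (back (ag i) x'))) //= [X in _ + X]big1 ?addr0; last first.
    by move=> z' /negPf zn; apply: big1 => y _; rewrite zn mul0r mulr0.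
  rewrite /step_cgf /cgf lnK ?posrE ?mgf_gt0//; last exact: Et_sum1.
  apply: (@le_trans _ _ (1 * mgf (Et ^~ (back (ag i) x'))
    (Et ^~ (back (ag i) x)) (- s (ag i)))); last by rewrite mul1r.
  have -> : \sum_y T (lshift r (back (ag i) x')) z * E y (lshift r (back (ag i) x')) *
     ((lshift r (back (ag i) x') == lshift r (back (ag i) x'))%:R *
       expR (- (s (ag i) * L (ag i) y))) = T (lshift r (back (ag i) x')) z *
       mgf (Et ^~ (back (ag i) x')) (Et ^~ (back (ag i) x)) (- s (ag i)).
    rewrite mulr_sumr; apply: eq_bigr => y _; rewrite eqxx mul1r -mulrA mxE.
    congr (_ * (_ * _)); rewrite /powR gt_eqF ?divr_gt0//.
      rewrite ln_div ?posrE//; first by rewrite mulNr /L !mxE.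
      by have := hE y (back (ag i) x'); rewrite mxE.
    by have := hE y (back (ag i) x'); rewrite mxE.
  apply: ler_wpM2r; last exact: (transition_le1 hH).
  by apply/ltW/mgf_gt0 => //; exact: Et_sum1.
- by move=> i; rewrite /b; case: ifP => // _; exact: expR_ge0.
- exact: expR_ge0.
- move=> t [hX hw]; rewrite (prodE (fun i => g i (X i t) (X i.+1 t) (Y i.+1 t))); last first.
    by move=> i ik; rewrite /g ik.
  have -> : \prod_(j < K) g (k0 + K - j.+1)%N (X (k0 + K - j.+1)%N t)
      (X (k0 + K - j.+1).+1 t) (Y (k0 + K - j.+1).+1 t) =
      expR (\sum_(j < K) - (s j * L j (Y (k0 + K - j)%N t))).
    rewrite expR_sum; apply: eq_bigr => j _.
    by rewrite /g (geE _ (ltn_ord j)) (agE _ (ltn_ord j)) (SE _ (ltn_ord j)) hX// eqxx mul1r.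
  (* On the event, the weighted log-likelihood ratios sum to at most (1 - delta)^K times the
     difference of the filter values at time k0, hence to at most 2 W (1 - delta)^K. *)
  rewrite -expRD -[leLHS]expR0 ler_expR sumrN subr_ge0.
  move: hw; rewrite !rec_filter_unroll.
  set A := rf k0 t (back K x'); set B := rf k0 t (back K x).
  have hA : `|A| <= W by exact: rec_filter_bound.
  have hB : `|B| <= W by exact: rec_filter_bound.
  move: hA hB; rewrite !ler_norml => /andP[A1 A2] /andP[B1 B2] hw.
  have e1 : \sum_(j < K) s j * L j (Y (k0 + K - j)%N t) = c / delta *
    (\sum_(j < K) delta * (1 - delta) ^+ j * ln (Et (Y (k0 + K - j)%N t) (back j x')) -
     \sum_(j < K) delta * (1 - delta) ^+ j * ln (Et (Y (k0 + K - j)%N t) (back j x))).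
    rewrite -sumrB mulr_sumr; apply: eq_bigr => j _; rewrite /s /L.
    by field; rewrite gt_eqF.
  rewrite e1 ler_pM2l ?divr_gt0//.
  have p0 : 0 <= (1 - delta) ^+ K by rewrite exprn_ge0//; lra.
  have hBA : B - A <= 2 * W by lra.
  have := ler_wpM2r p0 hBA; move: hw.
  set Sx' := \sum_(j < K) _; set Sx := \sum_(j < K) _.
  move: ((1 - delta) ^+ K) => q hw h1; lra.
Qed.

End Chernoff.

Lemma sum_residues {R : realType} (M I : nat) (F : nat -> R) :
  \sum_(j < M * I) F j = \sum_(n < M) \sum_(i < I) F (n + M * i)%N.
Proof.
elim: I => [|I IH].
  by rewrite muln0 big_ord0 big1// => n _; rewrite big_ord0.
rewrite mulnSr big_split_ord /= IH.
under [RHS]eq_bigr do rewrite big_ord_recr /=.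
by rewrite big_split /=; congr (_ + _); apply: eq_bigr => n _; rewrite addnC.
Qed.

Lemma logit_filter_obs {R : realType} {N S : nat} (A : 'M[R]_N) (E : 'M[R]_(S, N))
    delta w0 y y' k : (forall j, (1 <= j <= k)%N -> y j = y' j) ->
  logit_filter A E delta w0 y k = logit_filter A E delta w0 y' k.
Proof.
elim: k => //= k IH h; rewrite IH; last by move=> j /andP[j0 jk]; rewrite h// j0 ltnW.
by rewrite h ?leqnn.
Qed.

(** * The Chernoff exponent, compared with the integrals in [xi] *)

Section Exponent.
Context {R : realType} {m S M : nat}.
Variables (Et : 'M[R]_(S, m)) (sigma : 'S_m) (wt0 : 'cV[R]_m).
Hypothesis M0 : (0 < M)%N.
Hypothesis hE : forall y x, 0 < Et y x.
Hypothesis hE1 : forall x, \sum_y Et y x = 1.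
Hypothesis sM : (sigma ^+ M = 1)%g.
Notation back := (back sigma).
Notation c := (M%:R^-1 : R).

(** This is minus [Lambda_int]. It vanishes at residues outside [GammaSet], where the two
    likelihoods coincide, so sums may run over all residues. *)
Definition slope_mass (x' x : 'I_m) (n : nat) : R :=
  slope_int (Et ^~ (back n x')) (Et ^~ (back n x)) (- c) 0.

Lemma kl_same (p : 'I_S -> R) : (forall y, 0 < p y) -> kl p p = 0.
Proof.
by move=> p0; rewrite /kl big1// => y _; rewrite divff ?gt_eqF// ln1 mulr0.
Qed.

Lemma slope_int_same (p : 'I_S -> R) a b : (forall y, 0 < p y) -> \sum_y p y = 1 ->
  slope_int p p a b = 0.
Proof.
move=> p0 p1; rewrite /slope_int (_ : slope p p = fun=> 0).
  by rewrite Rintegral_cst// mul0r.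
apply/funext => t; rewrite /slope /cgf /mgf.
under eq_bigr do rewrite divff ?gt_eqF// powR1 mulr1.
by rewrite p1 ln1 mul0r.
Qed.

Lemma notin_GammaSet x' x (n : 'I_M) : n \notin GammaSet Et sigma M x' x ->
  Et ^~ (back n x) = Et ^~ (back n x').
Proof.
rewrite inE negbK => /eqP /colP h; apply/funext => y.
by have := h y; rewrite !mxE.
Qed.

Lemma in_GammaSet x' x (n : 'I_M) : n \in GammaSet Et sigma M x' x ->
  exists y, Et y (back n x') != Et y (back n x).
Proof.
rewrite inE => h; apply/existsP; apply: contraR h => /existsPn h.
by apply/eqP/colP => y; rewrite !mxE; apply/esym/eqP; have := h y; rewrite negbK.
Qed.

Lemma sum_slope_mass x' x :
  \sum_(n in GammaSet Et sigma M x' x) Lambda_int Et sigma M x' n x =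
  - \sum_(n < M) slope_mass x' x n.
Proof.
rewrite big_mkcond -sumrN; apply: eq_bigr => n _; case: ifPn => // /notin_GammaSet e.
by rewrite /slope_mass e slope_int_same ?oppr0.
Qed.

Lemma sum_dcoef x' x :
  \sum_(n in GammaSet Et sigma M x' x) dcoef Et sigma x' n x =
  \sum_(n < M) kl (Et ^~ (back n x')) (Et ^~ (back n x)).
Proof.
rewrite big_mkcond; apply: eq_bigr => n _; case: ifPn => // /notin_GammaSet e.
by rewrite e kl_same.
Qed.

Lemma c_gt0 : 0 < c. Proof. by rewrite invr_gt0 ltr0n. Qed.
Lemma c_le1 : c <= 1. Proof. by rewrite invf_le1 ?ltr0n// ler1n. Qed.

Lemma slope_mass_ge0 x' x n : 0 <= slope_mass x' x n.
Proof. by apply: slope_int_ge0 => //; have := c_gt0; have := c_le1; lra. Qed.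

(** Total over the residues of the discretisation errors of order delta in [cgf_grid_sum], divided
    by delta; it does not depend on delta. *)
Definition exponent_const (x' x : 'I_m) : R :=
  \sum_(n < M) (slope_mass x' x n + c * kl (Et ^~ (back n x')) (Et ^~ (back n x))).

Lemma Wconst_ge0 : 0 <= Wconst Et wt0.
Proof. by rewrite /Wconst le_max normr_ge0. Qed.

(** After multiplication by delta, the grid estimate for each residue bounds the left side by c
    times the expression in [alpha_admissible], minus lambda, plus an error linear in delta. The
    window is long enough for (1 - delta)^(M I) <= exp (- alpha). *)
Lemma confusion_exponent (lambda alpha delta : R) I x' x :
  alpha_admissible Et sigma M wt0 lambda alpha -> x' != x ->
  0 < delta < 1 -> alpha <= delta * (M * I)%:R ->
  c / delta * (2 * Wconst Et wt0 * (1 - delta) ^+ (M * I.+1)) +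
  \sum_(j < M * I.+1) cgf (Et ^~ (back j x')) (Et ^~ (back j x)) (- (c * (1 - delta) ^+ j))
  <= exponent_const x' x - lambda / delta.
Proof.
move=> [a0 /(_ x' x)] adm xx d01 hI; have /andP[d0 d1] := d01.
move: (adm xx); rewrite sum_slope_mass sum_dcoef => {}adm.
have q1 : (1 - delta) ^+ (M * I) <= expR (- alpha).
  apply: (@le_trans _ _ (expR (- delta) ^+ (M * I))).
    by rewrite lerXn2r ?nnegrE ?expR_ge0//; [lra|exact: expR_ge1Dx].
  by rewrite -expRM_natl ler_expR mulrC; lra.
have W0 := Wconst_ge0.
have e0 := expR_gt0 (- alpha).
have q2 : (1 - delta) ^+ (M * I.+1) <= expR (- alpha).
  apply: le_trans q1; rewrite mulnSr exprD ger_pMr ?exprn_gt0 ?subr_gt0//.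
  by rewrite exprn_ile1//; lra.
rewrite -(ler_pM2l d0) mulrDr (sum_residues M I.+1 (fun j => cgf (Et ^~ (back j x'))
  (Et ^~ (back j x)) (- (c * (1 - delta) ^+ j)))) mulr_sumr.
have hS : \sum_(n < M) delta * \sum_(i < I.+1) cgf (Et ^~ (back (n + M * i) x'))
      (Et ^~ (back (n + M * i) x)) (- (c * (1 - delta) ^+ (n + M * i))) <=
    - (c * \sum_(n < M) slope_mass x' x n) +
    c ^+ 2 * expR (- alpha) * (\sum_(n < M) kl (Et ^~ (back n x')) (Et ^~ (back n x)))
    + delta * exponent_const x' x.
  rewrite /exponent_const !mulr_sumr -sumrN -!big_split /=.
  apply: ler_sum => n _.
  under eq_bigr do rewrite !back_periodic//.
  exact: cgf_grid_sum.
have h1 : delta * (c / delta * (2 * Wconst Et wt0 * (1 - delta) ^+ (M * I.+1))) <=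
    c * (2 * Wconst Et wt0 * expR (- alpha)).
  rewrite (_ : delta * _ = c * (2 * Wconst Et wt0 * (1 - delta) ^+ (M * I.+1))).
    by rewrite ler_pM2l ?c_gt0// ler_wpM2l// mulr_ge0.
  by rewrite mulrA [delta * _]mulrC divfK ?gt_eqF.
apply: le_trans (lerD h1 hS) _.
have cM : c * M%:R = 1 by rewrite mulVf// gt_eqF// ltr0n.
move: adm; rewrite -(ltr_pM2l c_gt0) mulr0.
set J := \sum_(n < M) slope_mass x' x n.
set L := \sum_(n < M) kl _ _.
have -> : c * (- J + lambda * M%:R + expR (- alpha) * (c * L + 2 * Wconst Et wt0)) =
  - (c * J) + lambda * (c * M%:R) + expR (- alpha) * (c ^+ 2 * L + c * (2 * Wconst Et wt0)).
  by ring.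
rewrite cM mulr1.
have -> : delta * (exponent_const x' x - lambda / delta) =
  delta * exponent_const x' x - lambda by field; rewrite gt_eqF.
move: (expR _) (exponent_const _ _) (M%:R^-1) => e ec c' h; lra.
Qed.

End Exponent.

(** * Union bound over switches and confusions *)

Section ErrorBound.
Context {R : realType} {m r S M : nat}.
Variables (P : 'M[R]_m) (D12 : 'M[R]_(m, r)) (D22 : 'M[R]_r).
Variables (Q : 'M[R]_(m + r)) (nu : 'I_(m + r) -> 'I_(m + r)) (sigma : 'S_m).
Variables (E : 'M[R]_(S, m + r)) (pi0 : 'cV[R]_(m + r)) (wt0 : 'cV[R]_m).
Variables (H : hmm_process R (m + r) S) (eps delta : R).
Notation D := (block_mx P D12 0 D22).
Hypothesis hcol : forall j, col j D = basis_vec (nu j).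
Hypothesis hsigma : forall x, P *m basis_vec x = basis_vec (sigma x).
Hypothesis hE : forall y x, 0 < lsubmx E y x.
Hypothesis hH : is_hmm H pi0 (D + eps *: Q) E.
Hypothesis M0 : (0 < M)%N.
Hypothesis sM : (sigma ^+ M = 1)%g.
Hypothesis eps0 : 0 <= eps.
Hypothesis d01 : 0 < delta < 1.
Notation X := (@state R (m + r) S H).
Notation Y := (@obs R (m + r) S H).
Notation Et := (lsubmx E).
Notation w k o := (logit_filter (block_mx P 0 0 1%:M) E delta
  (col_mx (map_mx (@EFin R) wt0) (const_mx (-oo)%E)) (fun j => Y j o) k).

Lemma filter_error_determined k : determined k
  [set o : hmm_space H | argmax (w k o) != [set X k o]%SET].
Proof.
by move=> t t' eX eY /=; rewrite (logit_filter_obs _ _ _ _ eY) eX.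
Qed.

Lemma pr_nu_switch i k : (i < k)%N ->
  fine_pr (hmm_prob H) [set o | X i.+1 o != nu (X i o)] <= - (eps * q_min nu Q).
Proof.
move=> ik; apply: (pr_switch hH) => // [|x].
  by rewrite oppr_ge0 mulr_ge0_le0// /q_min bigmin_le_id.
rewrite !mxE -(_ : D (nu x) x = 1); last by rewrite (DE hcol) eqxx.
rewrite !mxE opprD addrA subrr add0r lerN2 ler_wpM2l//.
exact: bigmin_le.
Qed.

Lemma pr_filter_error (alpha lambda : R) I k' k :
  alpha_admissible Et sigma M wt0 lambda alpha ->
  D22 ^+ k' = 0 -> alpha <= delta * (M * I)%:R -> (k' + M * I.+1 <= k)%N ->
  fine_pr (hmm_prob H) [set o | argmax (w k o) != [set X k o]%SET] <=
  (k' + M * I.+1)%:R * - (eps * q_min nu Q) +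
  (\sum_x' \sum_x expR (exponent_const (M := M) Et sigma x' x)) * expR (- (lambda / delta)).
Proof.
move=> adm nilD hI kk.
have c0 : 0 < M%:R^-1 :> R := c_gt0 M0.
set K := (M * I.+1)%N in kk *.
(* The [k'] steps from [k1] to [k0] empty the transient states; the observation window then runs
   from [k0] to [k]. *)
pose k0 := (k - K)%N; pose k1 := (k0 - k')%N.
have kE : (k0 + K)%N = k by rewrite /k0; lia.
have k0E : (k1 + k')%N = k0 by rewrite /k1 /k0; lia.
pose B (f : 'I_(k' + K) + 'I_m * 'I_m) : set (hmm_space H) := match f with
  | inl i => [set o | X (k1 + i).+1 o != nu (X (k1 + i)%N o)]
  | inr p => if p.1 == p.2 then set0
             else confusion E sigma wt0 delta k0 K p.1 p.2
  end.
have ltk (i : 'I_(k' + K)) : (k1 + i < k)%N by have := ltn_ord i; lia.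
have mB f : measurable (B f).
  case: f => [i|[x' x]].
    by apply: (determined_measurable hH); exact: (@switch_determined _ _ _ H nu _ _ (ltk i)).
  rewrite /B /=; case: ifP => _ //.
  by apply: (determined_measurable hH); exact: confusion_determined.
apply: (@le_trans _ _ (\sum_f fine_pr (hmm_prob H) (B f))).
  apply: pr_cover => //.
    exact: (determined_measurable hH (@filter_error_determined k)).
  move=> t /= err.
  have [/existsP[i hi]|/existsPn noswitch] :=
    boolP [exists i : 'I_(k' + K), X (k1 + i).+1 t != nu (X (k1 + i)%N t)].
    by exists (inl i).
  (* Without a switch the states follow [nu], hence are recurrent from [k0] on and are determined by
     the state [a] at time [k0]. *)
  have Xiter l : (l <= k' + K)%N -> X (k1 + l)%N t = iter l nu (X k1 t).
    elim: l => [|l IH] hl; first by rewrite addn0.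
    have := noswitch (Ordinal hl); rewrite negbK /= addnS => /eqP ->.
    by rewrite IH// ltnW.
  have [a ha] := nu_iter_nilpotent hcol hsigma nilD (X k1 t).
  have XK l : (l <= K)%N -> X (k0 + l)%N t = lshift r ((sigma ^+ l)%g a).
    move=> lK; rewrite -k0E -addnA Xiter ?leq_add2l// (addnC k' l) iterD ha.
    exact: (nu_iter_recurrent hcol hsigma).
  move: err; rewrite -{2}kE XK// => /(filter_error hsigma hE d01)[b ba hb].
  exists (inr ((sigma ^+ K)%g a, b)); rewrite /= eq_sym (negPf ba); split.
    move=> j jK; rewrite -addnBA ?(ltnW jK)// XK ?leq_subr//.
    by rewrite -(back_iter sigma j (K - j)) subnK// ltnW.
  by rewrite kE.
rewrite big_sumType /=; apply: lerD.
  rewrite mulr_natl -[X in _ *+ X](card_ord (k' + K)) -sumr_const.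
  by apply: ler_sum => i _; apply: pr_nu_switch (ltk i).
rewrite -(pair_bigA _ (fun x' x => fine_pr (hmm_prob H) (B (inr (x', x))))) /=.
rewrite mulr_suml; apply: ler_sum => x' _; rewrite mulr_suml; apply: ler_sum => x _.
case: eqVneq => xx; first by rewrite pr0 mulr_ge0// expR_ge0.
apply: le_trans (pr_confusion sigma wt0 hH hE d01 c0 k0 K x' x) _.
rewrite -expRD ler_expR.
apply: (confusion_exponent M0 hE (Et_sum1 hH) sM adm xx d01 hI).
Qed.

End ErrorBound.

(** * The Bayes-optimal decoder *)

Section PosteriorError.
Context {R : realType} {N : nat}.
Variable q : 'I_N -> R.
Hypothesis q0 : forall i, 0 <= q i.

(** Unnormalised conditional error of a set-valued decoder; as in [decoding_error], a set that is
    not a singleton errs whatever the true state. *)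
Definition miss (s : {set 'I_N}) : R := \sum_(i | s != [set i]%SET) q i.

Lemma miss_le s : miss s <= \sum_i q i.
Proof.
rewrite [leRHS](bigID (fun i => s != [set i]%SET)) /= lerDl.
by apply: sumr_ge0.
Qed.

Lemma miss1 i : miss [set i]%SET = \sum_i q i - q i.
Proof.
rewrite /miss (bigD1 (P := xpredT) i) //= addrAC subrr add0r.
by apply: eq_bigl => j; rewrite (inj_eq set1_inj) eq_sym.
Qed.

Lemma miss_notset1 s : (forall i, s != [set i]%SET) -> miss s = \sum_i q i.
Proof. by move=> h; apply: eq_bigl => i; rewrite h. Qed.

(* A tie at the top forces the largest posterior weight to be at most one half;
   this is what the factor 2 pays for. *)
Lemma miss_argmax (s g : {set 'I_N}) :
  (forall i, (i \in s) = [forall j, q j <= q i]) -> miss s <= 2 * miss g.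
Proof.
move=> hs; have mle := miss_le s.
have Q0 : 0 <= \sum_i q i by apply: sumr_ge0.
have [/existsP[i /eqP gi]|/existsPn hg] := boolP [exists i, g == [set i]%SET]; last first.
  by rewrite (miss_notset1 hg); lra.
rewrite gi miss1.
have qle : q i <= \sum_j q j by rewrite (bigD1 i) //= lerDl sumr_ge0.
have [/existsP[j /eqP sj]|/existsPn hns] := boolP [exists j, s == [set j]%SET].
  have : j \in s by rewrite sj set11.
  rewrite hs => /forallP /(_ i) h; rewrite sj miss1; lra.
rewrite (miss_notset1 hns).
have [u hu] : exists u, u \in s.
  pose u := [arg max_(j > i) q j]%O.
  exists u; rewrite hs; apply/forallP => j; rewrite /u.
  by case: arg_maxP => // k _ /(_ j isT).
(* A second maximiser exists as [s] is no singleton; both weights are at least q i and together at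
   most the total, so q i is at most half of it. *)
have /set0Pn[v] : (s :\ u)%SET != finset.set0.
  apply: contra (hns u) => /eqP h; apply/eqP/setP => z; rewrite finset.in_set1.
  case: eqVneq => [->//|zu]; apply/negP => zs.
  have : z \in (s :\ u)%SET by rewrite in_setD1 zu.
  by rewrite h inE.
rewrite in_setD1 => /andP[vu hv].
move: hu hv; rewrite !hs => /forallP/(_ i) hu /forallP/(_ i) hv.
have : q u + q v <= \sum_j q j.
  rewrite (bigD1 u) //= lerD2l (bigD1 v) //= lerDl; exact: sumr_ge0.
lra.
Qed.

End PosteriorError.

Section Bayes.
Context {R : realType} {N S : nat}.
Variables (H : hmm_process R N S) (pi0 : 'cV[R]_N) (T : 'M[R]_N).
Variables (E : 'M[R]_(S, N)).
Hypothesis hH : is_hmm H pi0 T E.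
Notation X := (@state R N S H).
Notation Y := (@obs R N S H).
Notation pr := (fine_pr (hmm_prob H)).

Lemma same_obsE k (o : hmm_space H) : same_obs k o = obs_word k @^-1` [set obs_word k o].
Proof.
apply/seteqP; split=> t /=.
  by move=> h; apply/ffunP => i; rewrite !ffunE; apply: h; exact: ltn_ord.
exact: obs_word_eq.
Qed.

Lemma belief_word k (o o' : hmm_space H) : obs_word k o = obs_word k o' -> belief k o = belief k o'.
Proof. by move=> e; apply/colP => i; rewrite !mxE !same_obsE e. Qed.

Lemma pr_miss k (C : set (hmm_space H)) (s : {set 'I_N}) : measurable C ->
  pr ([set o | s != [set X k o]%SET] `&` C) =
  miss (fun i => pr (X k @^-1` [set i] `&` C)) s.
Proof.
move=> mC; have [_ _ _ [mX _] _] := hH.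
have mA : measurable [set o | s != [set X k o]%SET].
  by apply: (@finite_image_measurable _ _ _ (X k)) => // t t' /= ->.
rewrite (pr_partition _ (measurableI _ _ mA mC) (mX k)) /miss [RHS]big_mkcond.
apply: eq_bigr => i _; case: ifPn => hi.
  congr (fine_pr _ _); apply/seteqP; split=> t /=; first by case=> [[_ ?] ->].
  by case=> -> Ct.
rewrite -(pr0 (hmm_prob H)); congr (fine_pr _ _); apply/seteqP; split=> t //=.
by case=> [[hs _] xi]; move: hi; rewrite -xi hs.
Qed.

Lemma word_error_measurable k (G : hmm_space H -> {set 'I_N}) :
  (forall o o', obs_word k o = obs_word k o' -> G o = G o') ->
  measurable [set o | G o != [set X k o]%SET].
Proof.
move=> hG; have [_ _ _ [mX _] _] := hH.
apply: (@finite_image_measurable _ _ _ (fun o => (X k o, obs_word k o))).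
  move=> [i f]; have -> : (fun o => (X k o, obs_word k o)) @^-1` [set (i, f)] =
      X k @^-1` [set i] `&` obs_word k @^-1` [set f].
    by apply/seteqP; split=> t /= [-> ->].
  by apply: measurableI; [exact: mX|exact: (obs_word_measurable hH)].
by move=> t t' [e1 e2] /=; rewrite e1 (hG _ _ e2).
Qed.

Lemma argmax_belief_word k (o o' : hmm_space H) :
  obs_word k o = obs_word k o' -> argmax (belief k o) = argmax (belief k o').
Proof. by move=> e; rewrite (belief_word e). Qed.

(** Both decoders are constant on the set of outcomes with a given observation word, so the
    comparison reduces to [miss_argmax] word by word. *)
Lemma pr_belief_error k (G : hmm_space H -> {set 'I_N}) :
  (forall o o', obs_word k o = obs_word k o' -> G o = G o') ->
  pr [set o | argmax (belief k o) != [set X k o]%SET] <=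
  2 * pr [set o | G o != [set X k o]%SET].
Proof.
move=> hG; have mW f := obs_word_measurable hH (k := k) f.
have [_ _ _ [mX _] _] := hH.
have mset := @word_error_measurable k.
have hbel := @argmax_belief_word k.
rewrite (pr_partition _ (mset _ hbel) mW) (pr_partition _ (mset _ hG) mW) mulr_sumr.
apply: ler_sum => f _; set C := obs_word k @^-1` [set f].
have [C0|/set0P[t Ct]] := eqVneq C set0.
  by rewrite C0 !setI0 pr0 mulr0.
have restr (G' : hmm_space H -> {set 'I_N}) :
    (forall o o', obs_word k o = obs_word k o' -> G' o = G' o') ->
    [set o | G' o != [set X k o]%SET] `&` C = [set o | G' t != [set X k o]%SET] `&` C.
  move=> hG'; apply/seteqP; split=> t' /= [h Ct']; split=> //.
    by rewrite (hG' t t')// Ct Ct'.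
  by rewrite (hG' t' t)// Ct Ct'.
have mC : measurable C := mW f.
rewrite (restr _ hbel) (restr _ hG) !pr_miss//.
set q := fun i => pr (X k @^-1` [set i] `&` C).
have q0 i : 0 <= q i by exact: pr_ge0.
have qsum : \sum_i q i = pr C.
  rewrite (pr_partition _ mC (mX k)); apply: eq_bigr => i _.
  by rewrite /q setIC.
(* On a null word [belief] is 0 / 0 = 0 and does not order the states, but the error there has
   probability 0. *)
have [pC0|pC] := eqVneq (pr C) 0.
  apply: le_trans (miss_le q0 _) _; rewrite qsum pC0 mulr_ge0//.
  by rewrite /miss sumr_ge0.
apply: miss_argmax => // i; rewrite inE; apply: eq_forallb => j.
have bE l : belief k t l 0 = (q l / pr C)%:E.
  by rewrite mxE same_obsE Ct.
rewrite !bE lee_fin ler_pM2r// invr_gt0 lt_neqAle eq_sym pC.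
exact: pr_ge0.
Qed.

End Bayes.

(** * Constants and asymptotics *)

Lemma limn_esup_le {R : realType} (u : nat -> \bar R) (b : \bar R) k0 :
  (forall k, (k0 <= k)%N -> (u k <= b)%E) -> (limn_esup u <= b)%E.
Proof.
move=> h; apply: (@le_trans _ _ (ereal_sup (u @` [set k | (k0 <= k)%N]))).
  by apply: ereal_inf_lbound; exists [set k | (k0 <= k)%N] => //; exists k0.
by apply: ge_ereal_sup => _ [k /= hk <-]; exact: h.
Qed.

Lemma le_sum2 {R : realType} {I J : finType} (F : I -> J -> R) :
  (forall i j, 0 <= F i j) -> forall i j, F i j <= \sum_i \sum_j F i j.
Proof.
move=> F0 i j; have row0 k : 0 <= \sum_j F k j by exact: sumr_ge0.
rewrite (bigD1 i) //=; apply: (@le_trans _ _ (\sum_j F i j)); last first.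
  by rewrite lerDl sumr_ge0.
by rewrite (bigD1 j) //= lerDl sumr_ge0.
Qed.

(** * Positivity of [xi] and existence of an admissible alpha *)

Section Constants.
Context {R : realType} {m S M : nat}.
Variables (Et : 'M[R]_(S, m)) (sigma : 'S_m) (P : 'M[R]_m) (wt0 : 'cV[R]_m).
Hypothesis M0 : (0 < M)%N.
Hypothesis hE : forall y x, 0 < Et y x.
Hypothesis hE1 : forall x, \sum_y Et y x = 1.
Hypothesis sM : (sigma ^+ M = 1)%g.
Hypothesis hsigma : forall x, P *m basis_vec x = basis_vec (sigma x).
Hypothesis hEs : forall x x' : 'I_m, x != x' ->
     col x (\mxcol_(n < M) (Et *m P ^+ n)) <>
     col x' (\mxcol_(n < M) (Et *m P ^+ n)).

(** Column z of [Et *m P ^+ n] is column sigma^n (z) of [Et], and sigma^n is the inverse of sigma^(M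
    - n). Equal likelihoods at every backward lag would thus make two stacked columns equal. *)
Lemma GammaSet_neq0 x' x : x != x' -> exists n, n \in GammaSet Et sigma M x' x.
Proof.
move=> xx; apply: contrapT => none; apply: (hEs xx).
have same l y : Et y (back sigma l x) = Et y (back sigma l x').
  rewrite (divn_eq l M) addnC mulnC !back_periodic//.
  have lM : (l %% M < M)%N by rewrite ltn_mod.
  have : Ordinal lM \notin GammaSet Et sigma M x' x.
    by apply/negP => h; apply: none; exists (Ordinal lM).
  by move/notin_GammaSet => /(congr1 (fun f => f y)).
have sameP n y : (n <= M)%N -> (Et *m P ^+ n) y x = (Et *m P ^+ n) y x'.
  move=> nM; have e z : (Et *m P ^+ n) y z = Et y ((sigma ^+ n)%g z).
    transitivity (col z (Et *m P ^+ n) y 0); first by rewrite [RHS]mxE.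
    rewrite colE -mulmxA -/(basis_vec z) (perm_mx_pow hsigma).
    by rewrite -colE mxE.
  have b z : (sigma ^+ n)%g z = back sigma (M - n) z.
    by have := back_iter sigma (M - n) n z; rewrite subnKC// sM perm1 => ->.
  by rewrite !e !b.
apply/colP => i; rewrite mxE [RHS]mxE mxE [RHS]mxE; apply: sameP; exact: ltnW.
Qed.

Lemma sum_slope_mass_gt0 x' x : x != x' -> 0 < \sum_(n < M) slope_mass (M := M) Et sigma x' x n.
Proof.
move=> xx; have [n hn] := GammaSet_neq0 xx.
rewrite (bigD1 n) //= ltr_pwDl//.
  apply: slope_int_gt0 => //; [exact: c_gt0|exact: c_le1|exact: in_GammaSet hn].
by apply: sumr_ge0 => j _; exact: slope_mass_ge0.
Qed.

Lemma xi_gt0 : (0 < xi Et sigma M)%E.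
Proof.
rewrite /xi; apply/bigmin_gtP; split=> // x' _.
apply/bigmin_gtP; split=> // x xx.
rewrite lte_fin sum_slope_mass// mulrN opprK mulr_gt0 ?sum_slope_mass_gt0//.
exact: c_gt0.
Qed.

Lemma xi_le x' x : x' != x -> (xi Et sigma M <=
  (M%:R^-1 * \sum_(n < M) slope_mass (M := M) Et sigma x' x n)%:E)%E.
Proof.
move=> xx; rewrite /xi; apply: le_trans (bigmin_le_cond _ _ (isT : xpredT x')) _.
apply: le_trans (bigmin_le_cond _ _ (_ : (fun x => x != x') x)) _.
  by rewrite eq_sym.
by rewrite lee_fin sum_slope_mass// mulrN opprK.
Qed.

Lemma admissible_exists lambda : 0 < lambda -> (lambda%:E < xi Et sigma M)%E ->
  exists alpha, alpha_admissible Et sigma M wt0 lambda alpha.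
Proof.
move=> l0 lxi.
pose J x' x := \sum_(n < M) slope_mass (M := M) Et sigma x' x n.
pose B x' x := M%:R^-1 * \sum_(n in GammaSet Et sigma M x' x) dcoef Et sigma x' n x +
  2 * Wconst Et wt0.
pose gap x' x := J x' x - lambda * M%:R.
have gap0 x' x : x' != x -> 0 < gap x' x.
  move=> xx; have := lt_le_trans lxi (xi_le xx).
  rewrite lte_fin -ltr_pdivrMl ?invr_gt0 ?ltr0n// invrK /gap subr_gt0.
  by rewrite mulrC.
have B0 x' x : 0 <= B x' x.
  rewrite /B addr_ge0 ?mulr_ge0 ?Wconst_ge0// sum_dcoef// sumr_ge0// => n _.
  exact: kl_ge0.
have t0 x' x : 0 <= (if x' != x then B x' x / gap x' x else 0).
  by case: ifP => // xx; rewrite divr_ge0// ltW// gap0.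
(* Admissibility asks for exp alpha > B / gap for every pair. As exp alpha >= alpha, it is enough
   that alpha exceeds the sum of these nonnegative ratios. *)
exists (1 + \sum_x' \sum_x (if x' != x then B x' x / gap x' x else 0)).
set alpha := 1 + _; split.
  by rewrite ltr_pwDl// sumr_ge0// => x' _; rewrite sumr_ge0.
move=> x' x xx; rewrite sum_slope_mass// -/(J x' x) -/(B x' x).
have hal : B x' x / gap x' x < alpha.
  have := le_sum2 t0 x' x; rewrite xx /alpha => h.
  by rewrite -[ltLHS]add0r ltr_leD.
have g0 := gap0 _ _ xx.
have : B x' x < gap x' x * expR alpha.
  rewrite -ltr_pdivrMl// mulrC; apply: lt_le_trans hal _.
  by apply: le_trans (expR_ge1Dx _); rewrite lerDr.
rewrite -(ltr_pM2l (expR_gt0 (- alpha))) [ltRHS]mulrCA -expRD addNr expR0 mulr1.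
by rewrite /gap; lra.
Qed.

End Constants.

Section QMin.
Context {R : realType} {N : nat}.
Variables (nu : 'I_N -> 'I_N) (Q : 'M[R]_N).
Hypothesis hQ : drift_generator nu Q.

Lemma q_min_le0 : q_min nu Q <= 0. Proof. exact: bigmin_le_id. Qed.

(** The columns of [Q] sum to 0 with nonnegative entries off [nu], so a column with a nonzero entry
    has a negative entry at [nu]. *)
Lemma q_min_lt0 : Q != 0 -> q_min nu Q < 0.
Proof.
have [hQ0 hQs] := hQ.
move=> Qn0; have [[i j] /= Qij] : exists p : 'I_N * 'I_N, Q p.1 p.2 != 0.
  apply: contrapT => h; move/eqP: Qn0; apply; apply/matrixP => i j; rewrite mxE.
  by apply/eqP; apply: contrapT => /negP hij; apply: h; exists (i, j).
apply: (@le_lt_trans _ _ (Q (nu j) j)); first exact: bigmin_le.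
have s0 : 0 <= \sum_(i | i != nu j) Q i j by apply: sumr_ge0 => k; exact: hQ0.
have [e|ij] := eqVneq i (nu j).
  by rewrite lt_neqAle -{1}e Qij /= hQs oppr_le0.
rewrite hQs oppr_lt0 (bigD1 i) //= ltr_pwDl//.
  by rewrite lt_neqAle eq_sym Qij hQ0.
by apply: sumr_ge0 => k /andP[]; move=> /hQ0.
Qed.

End QMin.

(** * Long-term error of both decoders at a fixed drift *)

Section Limsup.
Context {R : realType} {m r S M : nat}.
Variables (P : 'M[R]_m) (D12 : 'M[R]_(m, r)) (D22 : 'M[R]_r).
Variables (Q : 'M[R]_(m + r)) (nu : 'I_(m + r) -> 'I_(m + r)) (sigma : 'S_m).
Variables (E : 'M[R]_(S, m + r)) (pi0 : 'cV[R]_(m + r)) (wt0 : 'cV[R]_m).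
Variables (H : hmm_process R (m + r) S) (eps delta : R).
Notation D := (block_mx P D12 0 D22).
Hypothesis hcol : forall j, col j D = basis_vec (nu j).
Hypothesis hsigma : forall x, P *m basis_vec x = basis_vec (sigma x).
Hypothesis hE : forall y x, 0 < lsubmx E y x.
Hypothesis hH : is_hmm H pi0 (D + eps *: Q) E.
Hypothesis M0 : (0 < M)%N.
Hypothesis sM : (sigma ^+ M = 1)%g.
Hypothesis eps0 : 0 <= eps.
Hypothesis d01 : 0 < delta < 1.
Variables (alpha lambda : R) (k' : nat).
Hypothesis adm : alpha_admissible (lsubmx E) sigma M wt0 lambda alpha.
Hypothesis nilD : D22 ^+ k' = 0.
Notation w k o := (logit_filter (block_mx P 0 0 1%:M) E delta
  (col_mx (map_mx (@EFin R) wt0) (const_mx (-oo)%E)) (fun j => @obs R (m + r) S H j o) k).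

Definition confusion_mass : R :=
  \sum_x' \sum_x expR (exponent_const (M := M) (lsubmx E) sigma x' x).

Definition error_bound (e d : R) : R :=
  ((k' + 2 * M)%:R + alpha / d) * - (e * q_min nu Q) +
  confusion_mass * expR (- (lambda / d)).

Lemma pr_filter_error_eventually : exists k0, forall k, (k0 <= k)%N ->
  fine_pr (hmm_prob H) [set o | argmax (w k o) != [set state k o]%SET] <= error_bound eps delta.
Proof.
have /andP[d0 d1] := d01; have [a0 _] := adm.
(* The window uses I = t + 1, so that M I exceeds alpha / delta while M (I + 1) is at most alpha /
   delta + 2 M. *)
pose t := Num.truncn (alpha / (delta * M%:R)).
have MR0 : 0 < M%:R :> R by rewrite ltr0n.
have dM : 0 < delta * M%:R by exact: mulr_gt0.
have /andP[t1 t2] : t%:R <= alpha / (delta * M%:R) < t.+1%:R.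
  by apply: truncn_itv; rewrite divr_ge0 ?ltW.
exists (k' + M * t.+2)%N => k hk.
have hI : alpha <= delta * (M * t.+1)%:R.
  rewrite natrM mulrA -ler_pdivrMl// mulrC; exact: ltW.
apply: le_trans (pr_filter_error hcol hsigma hE hH M0 sM eps0 d01 adm nilD hI hk) _.
rewrite lerD2r ler_wpM2r//.
  by rewrite oppr_ge0 mulr_ge0_le0 ?q_min_le0.
have -> : (k' + M * t.+2 = k' + 2 * M + M * t)%N by rewrite mulnC; lia.
rewrite natrD lerD2l natrM.
apply: le_trans (ler_wpM2l (ltW MR0) t1) _.
rewrite le_eqVlt; apply/orP; left; apply/eqP; field.
by rewrite !gt_eqF.
Qed.

Lemma limsup_filter_error :
  (limn_esup (decoding_error (H := H) (fun k o => w k o)) <= (error_bound eps delta)%:E)%E.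
Proof.
have [k0 h] := pr_filter_error_eventually.
apply: (@limn_esup_le _ _ _ k0) => k hk; rewrite /decoding_error prE ?lee_fin ?h//.
by apply: (determined_measurable hH); exact: filter_error_determined.
Qed.

Lemma limsup_belief_error :
  (limn_esup (decoding_error (H := H) (@belief _ _ _ H)) <= (2 * error_bound eps delta)%:E)%E.
Proof.
have [k0 h] := pr_filter_error_eventually.
apply: (@limn_esup_le _ _ _ k0) => k hk; rewrite /decoding_error prE; last first.
  by apply: (word_error_measurable hH); exact: argmax_belief_word.
rewrite lee_fin.
apply: (@le_trans _ _ (2 * fine_pr (hmm_prob H)
    [set o | argmax (w k o) != [set state k o]%SET])).
  apply: (pr_belief_error hH (G := fun o => argmax (w k o))) => t t' /obs_word_eq e.
  by rewrite (logit_filter_obs _ _ _ _ e).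
by rewrite ler_pM2l// h.
Qed.

End Limsup.

(** * Small drift *)

Section Asymptotics.
Context {R : realType}.

Lemma near0_lt (b : R) : 0 < b -> \forall e \near (0:R)^'+, e < b.
Proof. by move=> b0; apply: nbhs_right_lt. Qed.

Lemma eps_little_o (C : R) :
  (fun e : R => C * e) =o_ ((0:R)^'+) (fun e => e * ln e^-1).
Proof.
apply/eqoP => a a0; near=> e.
have e0 : 0 < e by near: e; exact: nbhs_right_gt.
(* Below this threshold ln (1 / e) is at least |C| / a. *)
have h : e < expR (- (`|C| / a)) by near: e; apply: near0_lt; exact: expR_gt0.
have h2 : `|C| / a <= ln e^-1.
  rewrite lnV ?posrE// lerNr; apply: ltW.
  by rewrite -[ltRHS]expRK ltr_ln ?posrE ?expR_gt0.
have l0 : 0 <= ln e^-1 by apply: le_trans h2; rewrite divr_ge0 // ltW.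
rewrite !normrM (gtr0_norm e0) (ger0_norm l0) mulrCA [leLHS]mulrC ler_pM2l//.
by rewrite mulrC -ler_pdivrMr.
Unshelve. all: by end_near. Qed.

Lemma log_delta_small (lambda : R) : 0 < lambda ->
  \forall e \near (0:R)^'+, 0 < lambda / ln e^-1 < 1.
Proof.
move=> l0; near=> e.
have e0 : 0 < e by near: e; exact: nbhs_right_gt.
have h : e < expR (- lambda) by near: e; apply: near0_lt; exact: expR_gt0.
have h2 : lambda < ln e^-1.
  by rewrite lnV ?posrE// ltrNr -[ltRHS]expRK ltr_ln ?posrE ?expR_gt0.
have L0 : 0 < ln e^-1 by apply: lt_trans h2.
by rewrite divr_gt0// ltr_pdivrMr// mul1r.
Unshelve. all: by end_near. Qed.

End Asymptotics.

Theorem theorem5p7 (R : realType) (m r S M : nat)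
  (P : 'M[R]_m) (D12 : 'M[R]_(m, r)) (D22 : 'M[R]_r)
  (D Q : 'M[R]_(m + r)) (nu : 'I_(m + r) -> 'I_(m + r)) (sigma : 'S_m)
  (E : 'M[R]_(S, m + r)) (pi0 : 'cV[R]_(m + r))
  (w0 : 'cV[\bar R]_(m + r)) (wt0 : 'cV[R]_m)
  (H : R -> hmm_process R (m + r) S) (delta : R -> R)
  (hD : D = block_mx P D12 0 D22)
  (hcol : forall j, col j D = basis_vec (nu j))
  (hP : is_perm_mx P)
  (hsigma : forall x, P *m basis_vec x = basis_vec (sigma x))
  (hM : is_mx_order P M)
  (hD22 : nilpotent_mx D22)
  (hQ : drift_generator nu Q)
  (hH : \forall eps \near 0^'+, is_hmm (H eps) pi0 (D + eps *: Q) E)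
  (hw0 : w0 = col_mx (map_mx (@EFin R) wt0) (const_mx (-oo)%E))
  (hE : forall y x, 0 < lsubmx E y x)
  (hEs : forall x x' : 'I_m, x != x' ->
     col x (\mxcol_(n < M) (lsubmx E *m P ^+ n)) <>
     col x' (\mxcol_(n < M) (lsubmx E *m P ^+ n)))
  (hdelta : \forall eps \near 0^'+, 0 < delta eps < 1) :
  let w eps k o :=
    logit_filter (block_mx P 0 0 1%:M) E (delta eps) w0
      (fun j => obs (h := H eps) j o) k in
  let limsup_error eps := limn_esup (decoding_error (H := H eps) (w eps)) in
  let limsup_bayes_error eps :=
    limn_esup (decoding_error (H := H eps) (@belief _ _ _ (H eps))) in
  let xi0 := xi (lsubmx E) sigma M in
  [/\ (delta eps @[eps --> 0^'+] --> 0 ->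
       eps / delta eps @[eps --> 0^'+] --> 0 ->
       limsup_error eps @[eps --> 0^'+] --> 0%E),
      (0 < xi0)%E,
      (forall lambda : R, 0 < lambda -> (lambda%:E < xi0)%E ->
       (exists alpha : R, alpha_admissible (lsubmx E) sigma M wt0 lambda alpha) /\
       (forall alpha : R, alpha_admissible (lsubmx E) sigma M wt0 lambda alpha ->
          (Q != 0 -> 0 < kappa nu Q alpha lambda) /\
          ((\forall eps \near 0^'+, delta eps = lambda / ln (eps^-1)) ->
           eps_log_bound limsup_error (kappa nu Q alpha lambda)))) &
      (exists2 c : R, 0 < c & eps_log_bound limsup_bayes_error c)].
Proof.
move=> w limsup_error limsup_bayes_error xi0.
subst D w0.
have [M0 PM _] := hM.
have sM : (sigma ^+ M = 1)%g := perm_order hsigma PM.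
have [k' nilD] := hD22.
(* [E] does not depend on the drift, so its stochasticity is read off at any one small value. *)
have hE1 x : \sum_y lsubmx E y x = 1.
  near ((0 : R)^'+) => e.
  have he : is_hmm (H e) pi0 (block_mx P D12 0 D22 + e *: Q) E by near: e.
  exact: (Et_sum1 he).
have xipos : (0 < xi0)%E by exact: (xi_gt0 M0 hE hE1 sM hsigma hEs).
have qm0 : q_min nu Q <= 0 by exact: q_min_le0.
pose bnd alpha lambda := error_bound (M := M) Q nu sigma E alpha lambda k'.
pose A := confusion_mass (M := M) sigma E.
pose C0 := (k' + 2 * M)%:R * - q_min nu Q + A.
(* At delta = lambda / ln (1 / e), exp (- lambda / delta) is exactly e, so only the window length
   produces a logarithm. *)
have boundE (alpha lambda e : R) : 0 < lambda -> 0 < e -> 0 < lambda / ln e^-1 ->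
    bnd alpha lambda e (lambda / ln e^-1) =
    kappa nu Q alpha lambda * (e * ln e^-1) + C0 * e.
  move=> l0 e0 L0; have Ln0 : ln e^-1 != 0.
    by apply: contraTneq L0 => ->; rewrite invr0 mulr0 ltxx.
  have ln0 : lambda != 0 by rewrite gt_eqF.
  rewrite /bnd /error_bound -/A.
  have -> : lambda / (lambda / ln e^-1) = ln e^-1 by field; rewrite ln0 Ln0.
  rewrite {2}lnV ?posrE// opprK lnK ?posrE// /kappa /C0.
  by field; rewrite ln0 Ln0.
(* An auxiliary rate for the two claims that do not fix lambda. With a single recurrent state [xi0]
   is +oo and the rate 1 is taken. *)
have [l0 l00 l0xi] : exists2 l0 : R, 0 < l0 & (l0%:E < xi0)%E.
  case: xi0 xipos => [x x0|_|//]; last by exists 1; rewrite // ltry.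
  by exists (x / 2); rewrite ?lte_fin in x0 *; lra.
have [a0 adm0] := admissible_exists wt0 M0 hE hE1 l00 l0xi.
have [a00 _] := adm0.
split=> //.
- move=> hd hed.
  (* The exponential term is bounded by exp (- l0 / delta) <= delta / l0, which leaves a combination
     of e, e / delta and delta, all tending to 0. *)
  pose B e : R := C0 * e + a0 * - q_min nu Q * (e / delta e) + A / l0 * delta e.
  have A0 : 0 <= A by rewrite sumr_ge0// => x' _; rewrite sumr_ge0// => x _; exact: expR_ge0.
  have B0 : B e @[e --> 0^'+] --> 0.
    rewrite -[X in _ --> X](_ : C0 * 0 + a0 * - q_min nu Q * 0 + A / l0 * 0 = 0); last first.
      by rewrite !mulr0 !addr0.
    apply: cvgD; [apply: cvgD|]; apply: cvgM => //; try exact: cvg_cst.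
    by apply: cvg_at_right_filter; exact: cvg_id.
  apply: (@squeeze_cvge _ _ _ _ (cst 0%E) _ (EFin \o B)).
  + near=> e; apply/andP; split.
      by apply: limf_esup_ge0 => [|k /=]; [exact: filter_not_empty|exact: measure_ge0].
    have e0 : 0 < e by near: e; exact: nbhs_right_gt.
    have he : is_hmm (H e) pi0 (block_mx P D12 0 D22 + e *: Q) E by near: e.
    have d01 : 0 < delta e < 1 by near: e.
    have /andP[d0 _] := d01.
    apply: le_trans (limsup_filter_error hcol hsigma hE he M0 sM (ltW e0) d01 adm0 nilD) _.
    rewrite lee_fin /error_bound -/A /B /C0.
    have h1 : expR (- (l0 / delta e)) <= delta e / l0.
      rewrite expRN -[leRHS]invf_div lef_pV2 ?posrE ?expR_gt0 ?divr_gt0//.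
      by apply: le_trans (expR_ge1Dx _); rewrite lerDr.
    have h2 := ler_wpM2l A0 h1.
    have h3 : 0 <= A * e by rewrite mulr_ge0// ltW.
    have e1 : A / l0 * delta e = A * (delta e / l0) by ring.
    have e2 : ((k' + 2 * M)%:R + a0 / delta e) * - (e * q_min nu Q) =
      (k' + 2 * M)%:R * - q_min nu Q * e + a0 * - q_min nu Q * (e / delta e) by ring.
    by rewrite e1 e2; lra.
  + exact: cvg_cst.
  + exact: (cvg_comp _ _ B0).
- move=> lambda lam0 lamxi; split; first exact: (admissible_exists wt0 M0 hE hE1).
  move=> alpha adm; have [al0 _] := adm; split.
    by move=> Q0; rewrite /kappa divr_gt0// mulr_gt0// oppr_gt0 q_min_lt0.
  move=> hdl; exists (fun e => C0 * e); first exact: eps_little_o.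
  near=> e.
  have e0 : 0 < e by near: e; exact: nbhs_right_gt.
  have he : is_hmm (H e) pi0 (block_mx P D12 0 D22 + e *: Q) E by near: e.
  have d01 : 0 < delta e < 1 by near: e.
  have dE : delta e = lambda / ln e^-1 by near: e.
  rewrite -boundE//; last by rewrite -dE; case/andP: d01.
  rewrite -dE.
  exact: (limsup_filter_error hcol hsigma hE he M0 sM (ltW e0) d01 adm nilD).
(* The comparison filter runs with its own parameter l0 / ln (1 / e) instead of the given [delta].
   The summand 1 keeps the constant positive when [Q] is 0. *)
- exists (2 * kappa nu Q a0 l0 + 1).
    have : 0 <= kappa nu Q a0 l0 by rewrite /kappa !mulr_ge0 ?invr_ge0 ?oppr_ge0// ltW.
    lra.
  exists (fun e => 2 * C0 * e); first exact: eps_little_o.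
  near=> e.
  have e0 : 0 < e by near: e; exact: nbhs_right_gt.
  have he : is_hmm (H e) pi0 (block_mx P D12 0 D22 + e *: Q) E by near: e.
  have d01 : 0 < l0 / ln e^-1 < 1 by near: e; exact: log_delta_small.
  have /andP[dpos _] := d01.
  have Lpos : 0 < ln e^-1 by rewrite -invr_gt0 -(pmulr_rgt0 _ l00).
  apply: le_trans (limsup_belief_error hcol hsigma hE he M0 sM (ltW e0) d01 adm0 nilD) _.
  rewrite -/(bnd _ _ _ _) boundE// lee_fin.
  have : 0 <= e * ln e^-1 by rewrite mulr_ge0 ?ltW.
  lra.
Unshelve. all: by end_near.
Qed.
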